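(* Let $K$ be a metric space and $f:K\to\mathbb{C}$ a bounded function. The following are equivalent. (a) $f\in SD(K)$. (b) (i) $\lim_{\varepsilon\to0}\varepsilon\, i(f,\omega,\varepsilon)=0$, and (ii) $i_D(f|W)\le\omega$ for all closed $W\subset K$.
   Context: $D(K)$ is the set of all $f:K\to\mathbb{C}$ of the form $f=(\varphi_1-\varphi_2)+i(\varphi_3-\varphi_4)$ with $\varphi_1,\dots,\varphi_4$ bounded real-valued lower semi-continuous functions on $K$. Equivalently, $f\in D(K)$ iff there is a sequence $(\varphi_j)$ of continuous complex-valued functions on $K$ with $\sup_{k\in K}\sum_j|\varphi_j(k)|<\infty$ and $f=\sum_j\varphi_j$ pointwise; $\|f\|_D$ is the infimum of $\sup_{k\in K}\sum_j|\varphi_j(k)|$ over all such sequences. A function is simple if its range is finite. $SD(K)$ is the closure, in $(D(K),\|\cdot\|_D)$, of the set of simple functions belonging to $D(K)$. All $\limsup$'s are non-exclusive (the point itself is allowed). For $\varphi:K\to[-\infty,\infty]$, $U\varphi(x)=\limsup_{y\to x}\varphi(y)$. Transfinite oscillations (of a complex function $f$ on any metric space): $\operatorname{osc}_0f\equiv0$. For an ordinal $\beta=\alpha+1$, $\widetilde{\operatorname{osc}}_\beta f(x)=\limsup_{y\to x}\bigl(|f(y)-f(x)|+\operatorname{osc}_\alpha f(y)\bigr)$; for a limit ordinal $\beta$, $\widetilde{\operatorname{osc}}_\beta f=\sup_{\alpha<\beta}\operatorname{osc}_\alpha f$; in both cases $\operatorname{osc}_\beta f=U\,\widetilde{\operatorname{osc}}_\beta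 f$. The $D$-index $i_D(f)$ is the least ordinal $\alpha$ with $\operatorname{osc}_\alpha f=\operatorname{osc}_{\alpha+1}f$; for $f|W$ it is computed in the metric subspace $W$. For a non-zero ordinal $\alpha$ and $\varepsilon>0$: $\operatorname{os}_0(f,\alpha,\varepsilon)=K$ and, with $L=\operatorname{os}_j(f,\alpha,\varepsilon)$, $\operatorname{os}_{j+1}(f,\alpha,\varepsilon)=\{x\in L:\operatorname{osc}_\alpha(f|L)(x)\ge\varepsilon\}$, with $\operatorname{osc}_\alpha(f|L)$ computed in the metric subspace $L$. Then $i(f,\alpha,\varepsilon)=\sup\{n\ge0:\operatorname{os}_n(f,\alpha,\varepsilon)\ne\emptyset\}\in\{0,1,2,\dots\}\cup\{\infty\}$. $\omega$ is the first infinite ordinal. *)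

(* Defs.v *)
From mathcomp Require Import all_boot all_order all_algebra.
From mathcomp Require Import all_classical all_reals all_analysis.
From mathcomp Require Import complex.

Set Implicit Arguments.
Unset Strict Implicit.
Unset Printing Implicit Defensive.

Import Order.TTheory GRing.Theory Num.Theory.
Import numFieldNormedType.Exports.
Import Normc.

Local Open Scope classical_set_scope.
Local Open Scope ring_scope.
Local Open Scope complex_scope.

(* Ordinals. [OSup a] is the least ordinal strictly greater than every [a i].
   A given ordinal has many representatives, so equality of ordinals is [Oeq],
   not Leibniz equality. *)
Inductive Ord : Type := OSup (T : Type) of (T -> Ord).

Fixpoint Ole (a b : Ord) : Prop :=
  let: OSup T u := a in let: OSup J v := b in
  forall i, exists j, Ole (u i) (v j).

Definition Olt (a b : Ord) : Prop :=
  let: OSup J v := b in exists j, Ole a (v j).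

Definition Oeq (a b : Ord) : Prop := Ole a b /\ Ole b a.

Definition Ozero : Ord := OSup (fun i : False => match i with end).
Definition Osucc (a : Ord) : Ord := OSup (fun _ : unit => a).
Definition Oomega : Ord := OSup (fun n : nat => iter n Osucc Ozero).

Definition Olimit (b : Ord) : Prop :=
  ~ Oeq b Ozero /\ ~ (exists a, Oeq b (Osucc a)).

Lemma Ole_refl a : Ole a a.
Proof. by elim: a => T u IH /= i; exists i. Qed.

Lemma Ole_trans a b c : Ole a b -> Ole b c -> Ole a c.
Proof.
elim: a b c => T u IH [J v] [L w] /= ab bc i.
by have [j uv] := ab i; have [l vw] := bc j; exists l; exact: IH uv vw.
Qed.

Lemma Oeq_sym a b : Oeq a b -> Oeq b a.
Proof. by case. Qed.

Lemma Oeq_trans a b c : Oeq a b -> Oeq b c -> Oeq a c.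
Proof.
by move=> [ab ba] [bc cb]; split; [exact: Ole_trans bc | exact: Ole_trans ba].
Qed.

Lemma Olt_le_trans a b c : Olt a b -> Ole b c -> Olt a c.
Proof.
case: b c => J v [L w] [j aj] bc; have [l jl] := bc j.
by exists l; exact: Ole_trans jl.
Qed.

Lemma Olt_wf : well_founded Olt.
Proof.
have H b : forall a, Ole a b -> Acc Olt a.
  elim: b => J v IH a ab; constructor=> c /Olt_le_trans/(_ ab) [j].
  exact: IH.
by move=> a; exact/H/Ole_refl.
Qed.

Lemma Olt_succ a b : Olt a (Osucc b) <-> Ole a b.
Proof. by split=> [[]|]; last exists tt. Qed.

Lemma Ole_succl a b : Ole (Osucc a) b <-> Olt a b.
Proof. by case: b => J v; split=> [/(_ tt)|h []]. Qed.

Lemma Oeq_succ_lt a b : Oeq b (Osucc a) -> Olt a b.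
Proof. by move=> [_ /Ole_succl]. Qed.

Lemma Oeq_succ_inj a b : Oeq (Osucc a) (Osucc b) -> Oeq a b.
Proof.
by case=> /Ole_succl/Olt_succ ab /Ole_succl/Olt_succ ba.
Qed.

Section oscillation.
Context {R : realType} {X : topologicalType}.
Implicit Type f : X -> R[i].
Local Open Scope ereal_scope.

(* [nbhs x] is the full neighbourhood filter: the point x itself is allowed. *)
Definition upper_reg (phi : X -> \bar R) (x : X) : \bar R :=
  limf_esup phi (nbhs x).

(* \tilde osc_(a+1) f, where [osc_] is osc_a f. *)
Definition osct_succ f (osc_ : X -> \bar R) (x : X) : \bar R :=
  limf_esup (fun y => (normc (f y - f x))%:E + osc_ y) (nbhs x).

Definition osc_step f (b : Ord) (rec : forall a, Olt a b -> X -> \bar R) :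
    X -> \bar R :=
  if pselect (Oeq b Ozero) then cst 0
  else match pselect (exists a, Oeq b (Osucc a)) with
  | left h => let: exist a ba := cid h in
      upper_reg (osct_succ f (rec a (Oeq_succ_lt ba)))
  | right _ => upper_reg (fun x =>
      ereal_sup [set r | exists a, exists ab : Olt a b, r = rec a ab x])
  end.

Definition osc (a : Ord) f : X -> \bar R :=
  Fix Olt_wf (fun _ => X -> \bar R) (@osc_step f) a.

Lemma oscE a f : osc a f = @osc_step f a (fun b _ => osc b f).
Proof.
apply: (Fix_eq Olt_wf (fun _ => X -> \bar R) (@osc_step f)) => b g h gh.
by congr osc_step; apply: functional_extensionality_dep => c;
  apply/funext => cb; exact: gh.
Qed.

Lemma osc_oeq f a b : Oeq a b -> osc a f = osc b f.
Proof.
elim/(well_founded_ind Olt_wf): a b => a IH b ab.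
rewrite !oscE /osc_step.
case: (pselect (Oeq a _)) => a0; case: (pselect (Oeq b _)) => b0 //.
- by case: b0; exact: Oeq_trans (Oeq_sym ab) a0.
- by case: a0; exact: Oeq_trans ab b0.
case: (pselect (exists _, Oeq a _)) => sa;
  case: (pselect (exists _, Oeq b _)) => sb.
- case: cid => c ac; case: cid => d bd; rewrite (IH c _ d) //.
    exact: Oeq_succ_lt.
  exact/Oeq_succ_inj/(Oeq_trans (Oeq_sym ac))/(Oeq_trans ab).
- by case: sb; case: sa => c ac; exists c; exact: Oeq_trans (Oeq_sym ab) ac.
- by case: sa; case: sb => c bc; exists c; exact: Oeq_trans ab bc.
congr upper_reg; apply/funext => x; congr ereal_sup; case: ab => ab ba.
by apply/seteqP; split=> r [c [h ->]]; exists c;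
  [exists (Olt_le_trans h ab) | exists (Olt_le_trans h ba)].
Qed.

Lemma osc_zero f : osc Ozero f = cst 0.
Proof.
by rewrite oscE /osc_step; case: pselect => // -[]; split; exact: Ole_refl.
Qed.

Lemma osc_succ f a : osc (Osucc a) f = upper_reg (osct_succ f (osc a f)).
Proof.
rewrite oscE /osc_step; case: pselect => [h|h0]; first by case: (h.1 tt).
case: pselect => [h|[]]; last by exists a; split; exact: Ole_refl.
by case: cid => b ab; rewrite (osc_oeq f (Oeq_succ_inj ab)).
Qed.

Lemma osc_limit f b : Olimit b -> osc b f =
  upper_reg (fun x => ereal_sup [set osc a f x | a in [set a | Olt a b]]).
Proof.
move=> [b0 bs]; rewrite oscE /osc_step; case: pselect => [//|?].
case: pselect => [//|?]; congr upper_reg; apply/funext => x; congr ereal_sup.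
by apply/seteqP; split=> r; [case=> a [ab ->]; exists a|
  case=> a ab <-; exists a, ab].
Qed.

Definition is_D_index f (a : Ord) : Prop :=
  osc a f = osc (Osucc a) f /\
  forall b, osc b f = osc (Osucc b) f -> Ole a b.

Definition D_index_le f (b : Ord) : Prop :=
  exists2 a, is_D_index f a & Ole a b.

End oscillation.

(* W carries the subspace topology, the only part of the metric that osc uses. *)
Definition restr {R : realType} {K : metricType R} (f : K -> R[i]) (W : set K) :
  W -> R[i] := fun w => f (set_val w).

(* Supremum in [0, +oo], so that the supremum of the empty set is 0. *)
Definition nnsup {R : realType} (A : set \bar R) : \bar R :=
  ereal_sup (0%E |` A).

Section spaces.
Context {R : realType} {K : metricType R}.
Implicit Types f g : K -> R[i].

Fixpoint os (n : nat) f (a : Ord) (e : R) : set K :=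
  if n is m.+1 then
    let L := os m f a e in
    [set set_val x | x in [set x : L | (e%:E <= osc a (@restr R K f L) x)%E]]
  else setT.

Definition os_index f (a : Ord) (e : R) : \bar R :=
  nnsup [set (n%:R)%:E | n in [set n | os n f a e !=set0]].

Definition bounded_lsc (phi : K -> R) : Prop :=
  (exists M : R, forall x, `|phi x| <= M) /\
  lower_semicontinuous (EFin \o phi).

Definition in_D f : Prop := exists phi1 phi2 phi3 phi4 : K -> R,
  [/\ bounded_lsc phi1, bounded_lsc phi2, bounded_lsc phi3, bounded_lsc phi4 &
      forall x, f x = (phi1 x - phi2 x) +i* (phi3 x - phi4 x)].

Definition sup_abs_series (phi : nat -> K -> R[i]) : \bar R :=
  nnsup [set (\sum_(0 <= j <oo) (normc (phi j k))%:E)%E | k in [set: K]].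

(* R[i]^o is R[i] with the topology of its modulus. *)
Definition represents f (phi : nat -> K -> R[i]) : Prop :=
  [/\ forall j, continuous (phi j : K -> R[i]^o),
      (sup_abs_series phi < +oo)%E &
      forall k, series (fun j => phi j k : R[i]^o) @ \oo --> (f k : R[i]^o)].

Definition D_norm f : \bar R :=
  ereal_inf [set sup_abs_series phi | phi in represents f].

Definition in_SD f : Prop := in_D f /\
  forall e : R, 0 < e ->
    exists g, [/\ in_D g, finite_set (range g) & (D_norm (f \- g)%R < e%:E)%E].

End spaces.

(* Main.v *)
(* Call V : X -> [0, oo[ a supersolution of f if, for every x, the limsup of
   |f y - f x| + V y as y -> x is at most V x.  Every osc_a f is then at most V,
   and if osc_a f = osc_(a+1) f is finite, then osc_a f is itself a
   supersolution.  A function in D(K) has a bounded supersolution: e minus the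
   sum of the |phi_j| if f is the sum of the phi_j and the sum of the |phi_j|
   stays below e.

   (a) => (b): write f = g + h with g simple and h of D-norm less than e.
   Pass repeatedly, from K on, to the set of points near which g is not constant
   on the current set.  On the n-th set a supersolution of g is at least n times
   the least distance between values of g, so the m-th set is empty for some m.
   Hence osc_m g is stable, and osc_w f and osc_(w+1) f differ by at most 2e.
   Moreover every supersolution of h is at least (n - m) eps on os_n(f, w, eps),
   whence limsup eps i(f, w, eps) <= e.

   (b) => (a): on L = os_j(f, w, eps), osc_w (f|L) is a supersolution of f|L,
   with values less than eps off os_(j+1)(f, w, eps).  There the real and the
   imaginary part of f are O(eps)-close, in the D-norm, to continuous functions,
   which rounded down to multiples of eps are simple and in D.  Glueing these
   approximations over the differences os_j minus os_(j+1), which number at most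
   i(f, w, eps) + 1, costs O(eps i(f, w, eps) + eps) in the D-norm. *)

Require Import Defs.
From mathcomp Require Import all_boot all_order all_algebra.
From mathcomp Require Import all_classical all_reals all_analysis.
From mathcomp Require Import complex ring lra.

Set Implicit Arguments.
Unset Strict Implicit.
Unset Printing Implicit Defensive.

Import Order.TTheory GRing.Theory Num.Theory.
Import numFieldNormedType.Exports.
Import Normc.

Local Open Scope classical_set_scope.
Local Open Scope ring_scope.

(** * Ordinals and transfinite oscillations *)

Section ordinals.

Lemma Ole_total a b : Ole a b \/ Olt b a.
Proof.
elim: a b => T u IH b.
have [h|/existsNP[i h]] := pselect (forall i, Olt (u i) b).
  by left; case: b h.
right; exists i; case: b h => J v h.
case E: (u i) => [S w] j; have := IH i (v j); rewrite E => -[uv|//].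
by case: h; exists j; rewrite E.
Qed.

Lemma Ole_eqVlt a b : Ole a b -> Oeq a b \/ Olt a b.
Proof. by move=> ab; case: (Ole_total b a) => ?; [left|right]. Qed.

Lemma Oltxx a : ~ Olt a a.
Proof. by elim/(well_founded_ind Olt_wf): a => a IH h; exact: (IH a). Qed.

Lemma Olt_ltS a b : Olt a b -> Olt a (Osucc b).
Proof.
move=> ab; apply/Olt_succ; elim: b a ab => J v IH [T u] [j] /=;
  case E: (v j) => [S w] h i.
have [k hk] := h i.
by exists j; have := IH j (u i); rewrite E /=; apply; exists k.
Qed.

Lemma Ole_ltW a b : Olt a b -> Ole a b.
Proof. by move/Olt_ltS/Olt_succ. Qed.

Lemma Ord_cases b : [\/ Oeq b Ozero, exists a, Oeq b (Osucc a) | Olimit b].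
Proof.
have [?|?] := pselect (Oeq b Ozero); first exact: Or31.
by have [?|?] := pselect (exists a, Oeq b (Osucc a)); [exact: Or32|exact: Or33].
Qed.

Lemma Ole0 a : Ole Ozero a.
Proof. by case: a => T u []. Qed.

Lemma Olt_zero a : ~ Olt a Ozero.
Proof. by move=> []. Qed.

Definition Onat n := iter n Osucc Ozero.

Lemma Onat_lt_omega n : Olt (Onat n) Oomega.
Proof. by exists n; exact: Ole_refl. Qed.

End ordinals.

Section oscillation_theory.
Context {R : realType} {X : topologicalType}.
Implicit Types (f : X -> R[i]) (phi V : X -> \bar R) (x : X).
Local Open Scope ereal_scope.

Lemma limf_esup_near phi x c : limf_esup phi (nbhs x) < c ->
  \forall y \near x, phi y < c.
Proof.
move=> /ereal_inf_lt[_ [V xV <-] Vc].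
apply: filterS xV => y Vy; apply: le_lt_trans Vc.
by apply: ereal_sup_ubound; exists y.
Qed.

Lemma limf_esup_le_near phi x c : (\forall y \near x, phi y <= c) ->
  limf_esup phi (nbhs x) <= c.
Proof.
move=> h; apply: ereal_inf_le; exists (ereal_sup (phi @` [set y | phi y <= c])).
  by exists [set y | phi y <= c].
by apply: ge_ereal_sup => _ [y yc <-].
Qed.

Lemma limf_esup_le phi x c : 0 <= c ->
  (forall d, c < d -> \forall y \near x, phi y <= d) ->
  limf_esup phi (nbhs x) <= c.
Proof.
case: c => [c| |] // _ h; last by rewrite leey.
apply/lee_addgt0Pr => e e0; apply/limf_esup_le_near/h.
by rewrite lte_fin ltrDl.
Qed.

Lemma limf_esup_ge phi x : phi x <= limf_esup phi (nbhs x).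
Proof.
rewrite leNgt; apply/negP => /limf_esup_near/nbhs_singleton.
by rewrite ltxx.
Qed.

Lemma upper_reg_usc phi x : (forall x, 0 <= phi x) ->
  upper_reg (upper_reg phi) x <= upper_reg phi x.
Proof.
move=> phi0; apply: limf_esup_le => [|d /limf_esup_near].
  exact: le_trans (limf_esup_ge _ _).
move=> /nbhs_interior; apply: filterS => y yd; apply: limf_esup_le_near.
by apply: filterS yd => z /ltW.
Qed.

Lemma osct_succ_ge f phi x : phi x <= osct_succ f phi x.
Proof.
apply: le_trans (limf_esup_ge _ _).
by rewrite subrr normc0 add0e.
Qed.

Lemma osc_ge0 a f x : 0 <= osc a f x.
Proof.
elim/(well_founded_ind Olt_wf): a x => a IH x.
have [a0|[b ab]|la] := Ord_cases a.
- by rewrite (osc_oeq f a0) osc_zero.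
- rewrite (osc_oeq f ab) osc_succ; apply: le_trans (limf_esup_ge _ _).
  by apply: le_trans (osct_succ_ge _ _ _); apply: IH; exact: Oeq_succ_lt.
rewrite osc_limit//; apply: le_trans (limf_esup_ge _ _).
have [/Oeq_sym a0|a0] := Ole_eqVlt (Ole0 a); first by case: la.
apply: le_ereal_sup_tmp; exists 0 => //; exists Ozero => //.
by rewrite osc_zero.
Qed.

Lemma osc_usc a f x : upper_reg (osc a f) x <= osc a f x.
Proof.
have [a0|[b ab]|la] := Ord_cases a.
- rewrite (osc_oeq f a0) osc_zero; apply: limf_esup_le_near.
  exact: nearW.
- rewrite (osc_oeq f ab) osc_succ; apply: upper_reg_usc => y.
  by apply: le_trans (osct_succ_ge _ _ _); exact: osc_ge0.
rewrite osc_limit//; apply: upper_reg_usc => y.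
have [/Oeq_sym a0|a0] := Ole_eqVlt (Ole0 a); first by case: la.
apply: le_ereal_sup_tmp; exists 0 => //; exists Ozero => //.
by rewrite osc_zero.
Qed.

Lemma osc_near a f x d : osc a f x < d -> \forall y \near x, osc a f y < d.
Proof. by move=> /(le_lt_trans (osc_usc _ _ _))/limf_esup_near. Qed.

Lemma osc_succ_ge f a x : osc a f x <= osc (Osucc a) f x.
Proof.
rewrite osc_succ; apply: le_trans (limf_esup_ge _ _); exact: osct_succ_ge.
Qed.

Lemma osc_mono f a b x : Ole a b -> osc a f x <= osc b f x.
Proof.
elim/(well_founded_ind Olt_wf): b a x => b IH a x /Ole_eqVlt[ab|ab].
  by rewrite (osc_oeq f ab).
have [b0|[c bc]|lb] := Ord_cases b.
- by case: (@Olt_zero a); apply: Olt_le_trans ab b0.1.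
- rewrite (osc_oeq f bc); apply: le_trans (osc_succ_ge _ _ _).
  apply: IH; first exact: Oeq_succ_lt.
  by apply/Olt_succ; apply: Olt_le_trans ab bc.1.
rewrite (osc_limit f lb); apply: le_trans (limf_esup_ge _ _).
by apply: le_ereal_sup_tmp; exists (osc a f x) => //; exists a.
Qed.

Lemma osct_succ_near f phi x : osct_succ f phi x <= phi x ->
  forall d, phi x < d ->
  \forall y \near x, (normc (f y - f x))%:E + phi y < d.
Proof. by move=> h d xd; apply/limf_esup_near/(le_lt_trans h). Qed.

Lemma normc_ge0 (z : R[i]) : (0 <= normc z)%R.
Proof. by case: z => a b; exact: sqrtr_ge0. Qed.

(** The hypothesis on [V] makes it upper semicontinuous, so upper regularisation keeps functions
    below [V] below it, and transfinite induction applies. *)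
Lemma osc_le_super f V : (forall x, 0 <= V x) ->
  (forall x, osct_succ f V x <= V x) -> forall a x, osc a f x <= V x.
Proof.
move=> V0 fV; elim/(well_founded_ind Olt_wf) => a IH x.
have usc phi : (forall y, phi y <= V y) -> upper_reg phi x <= V x.
  move=> phiV; apply: limf_esup_le => // d xd.
  apply: filterS (osct_succ_near (fV x) xd) => y /ltW; apply: le_trans.
  by apply: le_trans (phiV y) _; rewrite leeDr// lee_fin normc_ge0.
have [a0|[b ab]|la] := Ord_cases a.
- by rewrite (osc_oeq f a0) osc_zero; exact: V0.
- rewrite (osc_oeq f ab) osc_succ; apply: usc => y; apply: le_trans (fV y).
  apply: limf_esup_le => [|d yd].
    exact: le_trans (V0 y) (osct_succ_ge _ _ _).
  move/limf_esup_near: yd; apply: filterS => z /ltW; apply: le_trans.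
  by rewrite leeD2l// IH//; exact: Oeq_succ_lt.
rewrite osc_limit//; apply: usc => y; apply: ge_ereal_sup => _ [b ba <-].
exact: IH.
Qed.

End oscillation_theory.

(** * The D-index and stabilisation *)

Section D_index.
Context {R : realType} {X : topologicalType}.
Implicit Types (f : X -> R[i]) (x : X).
Local Open Scope ereal_scope.

Lemma osct_succ_stable f a x : osc a f = osc (Osucc a) f ->
  osct_succ f (osc a f) x <= osc a f x.
Proof. by move=> {2}->; rewrite osc_succ; exact: limf_esup_ge. Qed.

Lemma osc_stable f a b : (forall x, osct_succ f (osc a f) x <= osc a f x) ->
  Ole a b -> osc b f = osc a f.
Proof.
move=> fa ab; apply/funext => x; apply/le_anti/andP; split;
  last exact: osc_mono.
by apply: osc_le_super => // y; exact: osc_ge0.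
Qed.

(** A stable oscillation is its own supersolution, hence constant at all later ordinals; conversely,
    well-foundedness of [Olt] provides a least stable ordinal. *)
Lemma D_index_leP f b : D_index_le f b <-> osc b f = osc (Osucc b) f.
Proof.
split=> [[a [fa _] ab]|].
  have fa' x := osct_succ_stable x fa.
  rewrite !(@osc_stable _ a)//; apply: Ole_trans ab _.
  by apply: Ole_ltW; apply/Olt_succ; exact: Ole_refl.
(* The bound is decoupled from [b], so that the induction can descend to a smaller stable ordinal
   with [c] fixed. *)
move: b; suff H b : osc b f = osc (Osucc b) f -> forall c, Ole b c ->
  D_index_le f c.
  by move=> b /H; apply; exact: Ole_refl.
elim/(well_founded_ind Olt_wf): b => b IH fb c bc.
have [[d fd db]|nd] := pselect (exists2 d, osc d f = osc (Osucc d) f & Olt d b).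
  by apply: (IH d) => //; apply: Ole_trans bc; exact: Ole_ltW.
exists b => //; split=> // d fd.
by have [//|db] := Ole_total b d; case: nd; exists d.
Qed.

End D_index.

(** * Supersolutions *)

Section supersolutions.
Context {R : realType} {X : topologicalType}.
Implicit Types (f g h : X -> R[i]) (V : X -> R) (x : X).

(** The condition [osct_succ f V <= V] for finite [V], written with an error [e] so that real
    arithmetic applies. *)
Definition osc_super f V := (forall x, 0 <= V x) /\
  forall x e, 0 < e -> \forall y \near x, normc (f y - f x) + V y <= V x + e.

Lemma osc_super_opp f g V : osc_super (f \- g) V -> osc_super (g \- f) V.
Proof.
move=> [V0 fV]; split=> // x e e0; apply: filterS (fV x e e0) => y /=.
by rewrite -normcN; congr (normc _ + _ <= _); ring.
Qed.

Lemma osc_super_usc f V x e : osc_super f V -> 0 < e ->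
  \forall y \near x, V y <= V x + e.
Proof.
move=> [V0 fV] e0; apply: filterS (fV x e e0) => y; apply: le_trans.
by rewrite lerDr normc_ge0.
Qed.

(** Extended by [+oo] off [O], [V] is a global supersolution: as [O] is open, the limsup at a point
    of [O] only sees [O]. *)
Lemma osc_le_local f V (O : set X) : open O -> (forall x, O x -> 0 <= V x) ->
  (forall x e, O x -> 0 < e ->
     \forall y \near x, normc (f y - f x) + V y <= V x + e) ->
  forall a x, O x -> (osc a f x <= (V x)%:E)%E.
Proof.
move=> oO V0 fV a x Ox.
pose W y : \bar R := if y \in O then (V y)%:E else +oo%E.
have -> : (V x)%:E = W x by rewrite /W mem_set.
apply: osc_le_super => y.
  by rewrite /W; case: ifPn => // /set_mem /V0; rewrite lee_fin.
rewrite {2}/W; case: ifPn => [/set_mem Oy|_]; last by rewrite leey.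
apply/lee_addgt0Pr => e e0; apply: limf_esup_le_near.
have := open_nbhs_nbhs (conj oO Oy); apply: filterS2 (fV y e Oy e0) => z + Oz.
by rewrite /W mem_set// -!EFinD lee_fin.
Qed.

Local Open Scope ereal_scope.

Lemma limf_esup_leD (phi psi : X -> \bar R) V x c (v : R) : 0 <= c ->
  limf_esup psi (nbhs x) <= c ->
  (forall e, (0 < e)%R -> \forall y \near x, (V y <= v + e)%R) ->
  (forall y, phi y <= psi y + (V y)%:E) ->
  limf_esup phi (nbhs x) <= c + v%:E.
Proof.
case: c => [c| |] // _; last by move=> *; rewrite addye// leey.
move=> psic Vv phiV; apply/lee_addgt0Pr => e e0; apply: limf_esup_le_near.
have e20 : (0 < e / 2)%R by rewrite divr_gt0.
have : limf_esup psi (nbhs x) < (c + e / 2)%:E.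
  by apply: le_lt_trans psic _; rewrite lte_fin ltrDl.
move/limf_esup_near; apply: filterS2 (Vv _ e20) => y Vy /ltW psiy.
apply: le_trans (phiV y) _.
have -> : c%:E + v%:E + e%:E = (c + e / 2)%:E + (v + e / 2)%:E.
  by rewrite -!EFinD; congr _%:E; lra.
by apply: leeD => //; rewrite lee_fin.
Qed.

(** The increment of [f] is at most that of [g] plus that of [f - g]; the latter together with [V y]
    is asymptotically at most [V x]. *)
Lemma osct_succD f g V phi psi x : osc_super (f \- g)%R V ->
  0 <= phi x ->
  (forall y, psi y <= phi y + (V y)%:E) ->
  osct_succ f psi x <= osct_succ g phi x + (V x)%:E.
Proof.
move=> [V0 fgV] phi0 psiV; apply: limf_esup_leD (lexx _) (fgV x) _.
  exact: le_trans phi0 (osct_succ_ge _ _ _).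
move=> y; apply: le_trans (leeD2l _ (psiV y)) _ => /=.
have fgh : (normc (f y - f x) <=
    normc (g y - g x) + normc (f y - g y - (f x - g x)))%R.
  have -> : (f y - f x = (g y - g x) + (f y - g y - (f x - g x)))%R by ring.
  exact: le_normcD.
case: (phi y) => [r| |]; rewrite ?addNye ?addeNy ?addeNy ?addye ?addey ?leey
  ?leNye//.
rewrite -!EFinD lee_fin; lra.
Qed.

Lemma osc_nat_le f g V n x : osc_super (f \- g)%R V ->
  osc (Onat n) f x <= osc (Onat n) g x + (V x)%:E.
Proof.
move=> fgV; elim: n x => [|n IH] x.
  by rewrite /Onat /= !osc_zero add0e lee_fin; case: fgV.
rewrite /Onat /= !osc_succ; apply: limf_esup_leD.
- by apply: le_trans (limf_esup_ge _ _);
    apply: le_trans (osct_succ_ge _ _ _); exact: osc_ge0.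
- exact: lexx.
- by move=> e e0; apply: (osc_super_usc _ fgV e0).
- by move=> y; apply: osct_succD => //; exact: osc_ge0.
Qed.

End supersolutions.

(** * Simple functions *)

Section level_sets.
Context {R : realType} {X : topologicalType}.
Implicit Types (f g : X -> R[i]) (V : X -> R) (x : X).

(** A Cantor-Bendixson derivative in which local constancy of [g] along the set replaces isolation
    of the point. *)
Fixpoint nonconst n g : set X := if n is m.+1 then
  [set x | nonconst m g x /\ ~ \forall y \near x, nonconst m g y -> g y = g x]
  else setT.

Lemma near_nonconstC n g x : ~ nonconst n g x ->
  \forall y \near x, ~ nonconst n g y.
Proof.
elim: n x => [x|n IH x]; first by move=> /(_ I).
have [xn|/IH + _] := pselect (nonconst n g x); last first.
  by apply: filterS => y yn [].
move=> /not_andP[//|/contrapT] gx.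
have := nbhs_interior gx; apply: filterS2 gx => y yx gy [yn].
by apply; apply: filterS gy => z zx /zx ->; rewrite yx.
Qed.

Lemma nonconst_level m g x : ~ nonconst m g x ->
  exists2 j, (j < m)%N & nonconst j g x /\ ~ nonconst j.+1 g x.
Proof.
elim: m => [[]//|m IH] xm; have [xm'|/IH[j jm]] := pselect (nonconst m g x).
  by exists m.
by exists j => //; exact: leqW.
Qed.

Lemma finite_range_sep (T : Type) (g : T -> R[i]) : finite_set (range g) ->
  exists2 d : R, 0 < d & forall s t : T, g s <> g t -> d <= normc (g t - g s).
Proof.
move=> /finite_seqP[s gs].
have [d d0 sd] : exists2 d : R, 0 < d &
    forall p, p \in [seq (a, b) | a <- s, b <- s] -> p.1 <> p.2 ->
    d <= normc (p.2 - p.1).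
  elim: [seq _ | _ <- _, _ <- _] => [|p t [d d0 td]]; first by exists 1.
  have [p12|p12] := eqVneq p.1 p.2.
    by exists d => // q; rewrite inE => /predU1P[->|/td].
  exists (Num.min d (normc (p.2 - p.1))).
    rewrite lt_min d0 /= lt_neqAle normc_ge0 andbT eq_sym.
    by apply: contraNneq p12 => /eq0_normc/eqP; rewrite subr_eq0 eq_sym.
  move=> q; rewrite inE ge_min => /predU1P[->|/td h /h -> //].
  by rewrite lexx orbT.
exists d => // x y; apply: (sd (g x, g y)).
have sg z : g z \in s.
  by have : range g (g z) by []; rewrite gs.
by apply/allpairsP; exists (g x, g y); split; rewrite ?sg.
Qed.

(** Arbitrarily close to a point of [nonconst n.+1] lie points of [nonconst n] across which [g]
    jumps by at least [d], so each derivative adds [d] to the lower bound on [V]. *)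
Lemma nonconst_super g V d : osc_super g V -> 0 < d ->
  (forall x y, g x <> g y -> d <= normc (g y - g x)) ->
  forall n x, nonconst n g x -> n%:R * d <= V x.
Proof.
move=> [V0 gV] d0 gd; elim=> [|n IH] x; first by rewrite mul0r.
move=> [xn nx]; rewrite leNgt; apply/negP => Vx; apply: nx.
have e0 : 0 < (n.+1%:R * d - V x) / 2 by rewrite divr_gt0// subr_gt0.
apply: filterS (gV x _ e0) => y gy /IH yn.
apply: contrapT => /nesym /gd.
have E : n.+1%:R * d = n%:R * d + d by rewrite -natr1 mulrDl mul1r.
by move: yn gy Vx; rewrite E; set t := n%:R * d; lra.
Qed.

Lemma nonconst_eq0 g V M : osc_super g V -> (forall x, V x <= M) ->
  finite_set (range g) -> exists m, forall x, ~ nonconst m g x.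
Proof.
move=> gV VM /finite_range_sep[d d0 gd].
exists (Num.truncn (M / d)).+1 => x /(nonconst_super gV d0 gd).
by apply/negP; rewrite -ltNge (le_lt_trans (VM x))// -ltr_pdivrMr// truncnS_gt.
Qed.

Local Open Scope ereal_scope.

(* Near a point of [nonconst j], [g] is constant along [nonconst j], and off it
   one oscillation less is already stable. *)
Lemma osc_stable_level g j n x : (j <= n)%N -> ~ nonconst j.+1 g x ->
  osct_succ g (osc (Onat n) g) x <= osc (Onat n) g x.
Proof.
elim: j n x => [|j IH] n x jn.
  move=> /not_andP[/(_ I)//|/contrapT gx]; apply: limf_esup_le => [|d xd].
    exact: osc_ge0.
  apply: filterS2 gx (osc_near xd) => y /(_ I) -> /ltW.
  by rewrite subrr normc0 add0e.
move=> /not_andP[/IH h|/contrapT gx]; first by apply: h; exact: ltnW.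
case: n jn => // n jn.
have xgn : osct_succ g (osc (Onat n) g) x <= osc (Onat n.+1) g x.
  by rewrite /Onat /= osc_succ; exact: limf_esup_ge.
apply: limf_esup_le => [|d xd]; first exact: osc_ge0.
apply: filterS3 gx (osc_near xd) (limf_esup_near (le_lt_trans xgn xd)).
move=> y gy yd yd'; have [/gy ->|ny] := pselect (nonconst j.+1 g y).
  by rewrite subrr normc0 add0e ltW.
apply: le_trans (ltW yd'); rewrite leeD2l// /Onat /= osc_succ.
apply: limf_esup_le => [|e ye]; first exact: osc_ge0.
apply: filterS2 (near_nonconstC ny) (osc_near ye) => z nz /ltW.
by apply: le_trans; exact: IH.
Qed.

Lemma osc_stable_nonconst g m x : (forall y, ~ nonconst m g y) ->
  osct_succ g (osc (Onat m) g) x <= osc (Onat m) g x.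
Proof.
move=> gm; apply: (@osc_stable_level _ m) => // -[xm _]; exact: gm xm.
Qed.

(** With [m] such that [nonconst m g] is empty, osc_m g + W is a supersolution of [f], whence
    osc_(w+1) f <= osc_m g + W <= osc_m f + 2 W <= osc_w f + 2 W. *)
Lemma osc_omega_stable f :
  (forall e : R, (0 < e)%R -> exists g V W M, [/\ finite_set (range g),
    osc_super g V, forall x, (V x <= M)%R, osc_super (f \- g)%R W &
    forall x, (W x <= e)%R]) ->
  osc Oomega f = osc (Osucc Oomega) f.
Proof.
move=> fg; apply/funext => x; apply/le_anti/andP; split;
  first exact: osc_succ_ge.
apply/lee_addgt0Pr => e e0.
have [|g [V [W [M [gfin gV VM fgW We]]]]] := fg (e / 2)%R;
  first by rewrite divr_gt0.
have [m gm] := nonconst_eq0 gV VM gfin.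
pose U y := osc (Onat m) g y + (W y)%:E.
have W0 y : (0 <= W y)%R by case: fgW.
have fU y : osct_succ f U y <= U y.
  apply: le_trans (osct_succD (psi := U) fgW (osc_ge0 (Onat m) g y) _) _ => //.
  by apply: leeD2r; exact: osc_stable_nonconst.
have U0 y : 0 <= U y by rewrite adde_ge0// ?osc_ge0// lee_fin.
apply: le_trans (osc_le_super U0 fU _ _) _.
apply: le_trans (leeD2r _ (osc_nat_le m x (osc_super_opp fgW))) _.
rewrite -addeA; apply: leeD; first exact/osc_mono/Ole_ltW/Onat_lt_omega.
by rewrite -EFinD lee_fin; have := We x; lra.
Qed.

End level_sets.

(** * Necessity *)

Section complex_norm.
Context {R : realType}.

Lemma cvg_normcP (T : Type) (F : set_system T) (FF : Filter F)
    (u : T -> R[i]^o) (l : R[i]) :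
  u @ F --> (l : R[i]^o) <->
  forall e : R, 0 < e -> \forall t \near F, normc (l - u t) < e.
Proof.
split=> [ul e e0|ul].
  have := proj1 (cvgrPdist_lt _ _) ul e%:C%C; rewrite ltcR => /(_ _ e0).
  by apply: filterS => t; rewrite ltcE => /andP[].
apply/cvgrPdist_lt => e; rewrite ltcE /= => /andP[/eqP eI e0].
by apply: filterS (ul _ e0) => t; rewrite ltcE /= eI eqxx => ->.
Qed.

Lemma normc_le (z : R[i]) : normc z <= `|complex.Re z| + `|complex.Im z|.
Proof.
case: z => a b /=; rewrite -[leRHS]ger0_norm ?addr_ge0// -sqrtr_sqr.
apply: ler_wsqrtr; rewrite sqrrD !real_normK ?num_real//.
by rewrite -addrA [_ *+ 2 + _]addrC addrA lerDl mulrn_wge0 ?mulr_ge0.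
Qed.

Lemma normc_sub_tri (a b c : R[i]) :
  normc (a - c) <= normc (a - b) + normc (b - c).
Proof. by rewrite -[a - c](subrKA b) le_normcD. Qed.

Lemma normc_subC (a b : R[i]) : normc (a - b) = normc (b - a).
Proof. by rewrite -opprB normcN. Qed.

End complex_norm.

(** * From D(K) and SD(K) to supersolutions *)

Section super_of_D.
Context {R : realType} {K : metricType R}.
Implicit Types (f g : K -> R[i]) (W : set K).

Lemma nbhs_restr W (w : W) (P : set K) :
  (\forall y \near set_val w, P y) -> \forall y \near w, P (set_val y).
Proof. exact: (@initial_continuous W K set_val w). Qed.

Lemma restr_nbhs W (w : W) (P : set K) :
  (\forall y \near w, P (set_val y)) ->
  \forall y \near set_val w, W y -> P y.
Proof.
move=> [_ [[B oB <-] /= wB BP]].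
apply: filterS (open_nbhs_nbhs (conj oB wB)) => y By Wy.
exact: (BP (exist _ y (mem_set Wy)) By).
Qed.

Lemma osc_super_restr f V W :
  osc_super f V -> osc_super (@restr R K f W) (V \o set_val).
Proof.
move=> [V0 fV]; split=> [x|x e e0]; first exact: V0.
exact: nbhs_restr (fV _ _ e0).
Qed.

Lemma bounded_lsc_near (p : K -> R) x e : bounded_lsc p -> 0 < e ->
  \forall y \near x, p x - e < p y.
Proof.
move=> [_ lp] e0; have [|V xV Vp] := lp x (p x - e);
  first by rewrite lte_fin ltrBlDr ltrDl.
by apply: filterS xV => y /Vp.
Qed.

(** [V] is a constant minus the sum of the four functions. Semicontinuity makes their increments
    almost nonnegative, so |f y - f x| is almost at most the sum of the increments, which is the
    drop of [V]. *)
Lemma in_D_super f : in_D f ->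
  exists V M, osc_super f V /\ forall x, V x <= M.
Proof.
move=> [p1 [p2 [p3 [p4 [b1 b2 b3 b4 fE]]]]].
have [[M1 h1] _] := b1; have [[M2 h2] _] := b2.
have [[M3 h3] _] := b3; have [[M4 h4] _] := b4.
pose M := M1 + M2 + M3 + M4; exists (fun x => M - (p1 x + p2 x + p3 x + p4 x)).
have Mp x : `|p1 x + p2 x + p3 x + p4 x| <= M.
  by rewrite /M; do 3 apply: le_trans (ler_normD _ _) (lerD _ _) => //.
exists (M + M); split=> [|x]; last first.
  by rewrite lerD2l lerNl; have := Mp x; rewrite ler_norml => /andP[].
split=> [x|x e e0].
  by rewrite subr_ge0; have := Mp x; rewrite ler_norml => /andP[].
(* Each of the four functions contributes at most twice its error, and 4 * 2 * (e / 8) = e. *)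
have e80 : 0 < e / 8 by rewrite divr_gt0.
near=> y.
have g1 : p1 x - e / 8 < p1 y by near: y; exact: bounded_lsc_near.
have g2 : p2 x - e / 8 < p2 y by near: y; exact: bounded_lsc_near.
have g3 : p3 x - e / 8 < p3 y by near: y; exact: bounded_lsc_near.
have g4 : p4 x - e / 8 < p4 y by near: y; exact: bounded_lsc_near.
have := normc_le (f y - f x); set u := normc _; rewrite !fE /=.
by case: (ger0P (p1 y - p2 y - (p1 x - p2 x)));
  case: (ger0P (p3 y - p4 y - (p3 x - p4 x))); lra.
Unshelve. all: by end_near.
Qed.

Section series.
Variables (f : K -> R[i]) (phi : nat -> K -> R[i]) (e : R).
Hypotheses (fphi : represents f phi) (phie : (sup_abs_series phi < e%:E)%E).

Let T k : \bar R := (\sum_(0 <= j <oo) (normc (phi j k))%:E)%E.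
Let S n k := \sum_(0 <= j < n) phi j k.
Let s n k := \sum_(0 <= j < n) normc (phi j k).
Let t k := fine (T k).

Let Te k : (T k < e%:E)%E.
Proof.
by apply: le_lt_trans phie; apply: ereal_sup_ubound; right; exists k.
Qed.

Let T0 k : (0 <= T k)%E.
Proof. by apply: nneseries_ge0 => n _ _; rewrite lee_fin normc_ge0. Qed.

Let TE k : T k = (t k)%:E.
Proof. by rewrite fineK// ge0_fin_numE// (lt_trans (Te k)) ?ltry. Qed.

Let sE n k : (\sum_(0 <= j < n) (normc (phi j k))%:E)%E = (s n k)%:E.
Proof. by rewrite sumEFin. Qed.

Let st n k : s n k <= t k.
Proof.
rewrite -lee_fin -TE -sE; apply: nneseries_lim_ge => j _ _.
by rewrite lee_fin normc_ge0.
Qed.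

Let ts k d : 0 < d -> exists n, t k < s n k + d.
Proof.
move=> d0; apply: contrapT => /forallNP h.
have : (T k <= (t k - d)%:E)%E.
  apply: lime_le.
    by apply: is_cvg_nneseries => j _ _; rewrite lee_fin normc_ge0.
  apply: nearW => n; rewrite sE lee_fin; have := h n; lra.
rewrite TE lee_fin; lra.
Qed.

Let Ss n m k : normc (S (n + m) k - S n k) <= s (n + m) k - s n k.
Proof.
elim: m => [|m IH]; first by rewrite addn0 !subrr normc0.
rewrite addnS /S /s !big_nat_recr//= -/(S _ _) -/(S _ _) -/(s _ _) -/(s _ _).
by rewrite [in leLHS]addrAC [leRHS]addrAC (le_trans (le_normcD _ _))// lerD2r.
Qed.

Let fS n k : normc (f k - S n k) <= t k - s n k.
Proof.
apply/ler_addgt0Pr => d d0;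
  case: fphi => _ _ /(_ k)/cvg_normcP/(_ _ d0) [N _ h].
have /= := h (n + N)%N (leq_addl _ _); rewrite -/(S _ _) => hN.
have := normc_sub_tri (f k) (S (n + N) k) (S n k).
have := Ss n N k; have := st (n + N) k.
by move: hN; set a := normc _; set b := normc _; set c := normc _; lra.
Qed.

Let near_phi n x d : 0 < d ->
  \forall y \near x, \sum_(0 <= j < n) normc (phi j y - phi j x) < d.
Proof.
elim: n d => [|n IH] d d0; first by apply: nearW => y; rewrite big_geq.
have d20 : 0 < d / 2 by rewrite divr_gt0.
case: fphi => + _ _ => /(_ n x)/cvg_normcP/(_ _ d20).
apply: filterS2 (IH _ d20) => y;
  rewrite big_nat_recr//= [normc (phi n x - _)]normc_subC.
lra.
Qed.

Let S_phi n x y :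
  normc (S n y - S n x) <= \sum_(0 <= j < n) normc (phi j y - phi j x).
Proof.
rewrite /S -sumrB; elim: n => [|n IH]; first by rewrite !big_geq// normc0.
by rewrite !big_nat_recr//= (le_trans (le_normcD _ _))// lerD2r.
Qed.

Let s_phi n x y :
  s n x <= s n y + \sum_(0 <= j < n) normc (phi j y - phi j x).
Proof.
rewrite /s -big_split /=; apply: ler_sum => j _.
by rewrite normc_subC -{1}[phi j x](subrK (phi j y)) addrC le_normcD.
Qed.

(* The witness is [V x = e - \sum_j |phi_j x|]. *)
Lemma represents_super : exists V, osc_super f V /\ forall x, V x <= e.
Proof.
exists (fun x => e - t x); split=> [|x]; last first.
  by rewrite gerBl -lee_fin -TE.
split=> [x|x d d0]; first by rewrite subr_ge0 -lee_fin -TE ltW.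
have d40 : 0 < d / 4 by rewrite divr_gt0.
(* The tail beyond [n] is small at [x] but perhaps not at [y]; there it is part of [t y] and is paid
   for by the drop of [V]. The tail at [x] and the variation of the finite sum enter twice each,
   hence d / 4. *)
have [n xn] := ts x d40; apply: filterS (near_phi n x d40) => y yd.
have := fS n y; have := fS n x; have := S_phi n x y; have := s_phi n x y.
have := normc_sub_tri (f y) (S n y) (f x);
  have := normc_sub_tri (S n y) (S n x) (f x).
rewrite (normc_subC (S n x)); move: yd; set D := \sum_(_ <= _ < _) _.
set a := normc _; set b := normc _; set c := normc _; set a' := normc _;
  set b' := normc _.
lra.
Qed.

End series.

Lemma D_norm_super f (e : R) : (D_norm f < e%:E)%E ->
  exists V, osc_super f V /\ forall x, V x <= e.
Proof.
by move=> /ereal_inf_lt[_ [phi fphi <-] phie]; exact: represents_super phie.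
Qed.

Lemma in_SD_super f (e : R) : in_SD f -> 0 < e -> exists g V U M,
  [/\ finite_set (range g), osc_super g V, forall x, V x <= M,
      osc_super (f \- g) U & forall x, U x <= e].
Proof.
move=> [_ fD] e0; have [g [/in_D_super[V [M [gV VM]]] gfin]] := fD e e0.
by move=> /D_norm_super[W [gW We]]; exists g, V, W, M.
Qed.

Lemma in_SD_index f W : in_SD f -> D_index_le (@restr R K f W) Oomega.
Proof.
move=> fSD; apply/D_index_leP/osc_omega_stable => e e0.
have [g [V [U [M [gfin gV VM gU Ue]]]]] := in_SD_super fSD e0.
exists (@restr R K g W), (V \o set_val), (U \o set_val), M; split.
- by apply: sub_finite_set gfin => _ [x _ <-]; exists (set_val x).
- exact: osc_super_restr W gV.
- by move=> x; exact: VM.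
- exact: (osc_super_restr W gU).
- by move=> x; exact: Ue.
Qed.

Lemma osS n f a e x : os n.+1 f a e x <->
  exists2 w : os n f a e, x = set_val w &
    (e%:E <= osc a (@restr R K f (os n f a e)) w)%E.
Proof. by split=> [[w we <-]|[w -> we]]; exists w. Qed.

(* Each passage from [os n] to [os n.+1] costs [e] on [V], except where it
   reaches a point approached by [os n] from outside [nonconst j]: there upper
   semicontinuity of [V] transports the estimate of a lower level. *)
Lemma os_super f g V a e : 0 < e -> osc_super (f \- g) V ->
  forall n j x, os n f a e x -> ~ nonconst j.+1 g x ->
  (n%:R - j%:R) * e <= V x.
Proof.
move=> e0 [V0 fV]; elim=> [|n IH] j x.
  move=> _ _; apply: le_trans (V0 x); rewrite sub0r mulNr oppr_le0.
  by rewrite mulr_ge0// ltW.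
move=> /osS; set L := os n f a e => -[w xw ew] /nonconst_level[i ij [yi yi']].
rewrite ltnS in ij.
have Lx : L x by rewrite xw; exact: set_valP.
suff: (n.+1%:R - i%:R) * e <= V x.
  by apply: le_trans; rewrite ler_pM2r// lerD2l lerN2 ler_nat.
rewrite leNgt; apply/negP => Vx.
(* Near [x], a point [z] of [L] with [g z <> g x] would lie off [nonconst i]; the induction
   hypothesis one level down would make [V z] at least (n + 1 - i) e, too large for [V] near [x]. *)
have gx : \forall z \near x, L z -> g z = g x.
  move/not_andP : (yi') => [//|/contrapT].
  pose d := ((n.+1%:R - i%:R) * e - V x) / 2.
  have d0 : 0 < d by rewrite divr_gt0// subr_gt0.
  apply: filterS2 (fV x _ d0) => z Vz gz Lz; apply: gz; apply: contrapT.
  case: i {ij yi yi'} Vx @d d0 Vz => [|i] Vx d d0 Vz; first exact.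
  move=> /(IH _ _ Lz) Vz'.
  have E : (n.+1%:R - i.+1%:R) * e = (n%:R - i%:R) * e :> R.
    by rewrite -!natr1; ring.
  have := normc_ge0 ((f \- g) z - (f \- g) x).
  by move: Vz Vx; rewrite /d E; move: Vz'; set t := _ * e; set u := normc _;
    lra.
pose A := [set z | (L z -> g z = g x) /\ ~ nonconst i.+1 g z].
have xA : nbhs x A° by apply: nbhs_interior;
  exact: filterI gx (near_nonconstC yi').
have A0 z : A° z -> A z by exact: interior_subset.
have wA : A° (set_val w) by rewrite -xw; exact: nbhs_singleton.
have oA : open (set_val @^-1` A° : set L).
  by have /continuousP := @initial_continuous L K set_val; apply;
    exact: open_interior.
(* As [g] is constant on [L] near [x], [f] and [f - g] have the same increments there. So [U],
   nonnegative by the induction hypothesis, locally dominates every oscillation of [f] on [L], and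
   its value at [x] is at least [e]. *)
pose U (z : L) := V (set_val z) - (n%:R - i%:R) * e.
have U0 z : A° (set_val z) -> 0 <= U z.
  by move=> /A0[_ zi]; rewrite subr_ge0 IH//; exact: set_valP.
suff fU (z : L) d : A° (set_val z) -> 0 < d ->
    \forall y \near z, normc (@restr R K f L y - @restr R K f L z) + U y <= U
      z + d.
  have := le_trans ew (osc_le_local oA U0 fU a wA).
  rewrite lee_fin /U -xw; move: Vx; rewrite -natr1.
  rewrite !mulrDl mul1r; set t := _ * e; set u := _ * e; lra.
move=> zA d0; have /A0[gz _] := zA.
have zA' : \forall y \near set_val z, A° y.
  exact: open_nbhs_nbhs (conj (open_interior A) zA).
apply: filterS2 (nbhs_restr zA') (nbhs_restr (fV _ _ d0)) => y /A0[gy _].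
rewrite /restr /U /= gz ?gy; try exact: set_valP.
have -> : f (set_val y) - g x - (f (set_val z) - g x) = f (set_val y) - f
  (set_val z) by ring.
lra.
Qed.

End super_of_D.

(** * The limit of e times the index *)

Section index_limit.
Context {R : realType}.

Lemma cvge0P (T : Type) (F : set_system T) (FF : Filter F) (u : T -> \bar R) :
  (\forall t \near F, (0 <= u t)%E) ->
  u @ F --> 0%E <-> forall d : R, 0 < d -> \forall t \near F, (u t <= d%:E)%E.
Proof.
move=> u0; split=> [/fine_cvgP[ufin /cvgrPdist_le u0'] d d0|ud].
  apply: filterS2 ufin (u0' _ d0) => t tfin /=; rewrite sub0r normrN => h.
  by rewrite -(fineK tfin) lee_fin (le_trans (ler_norm _)).
apply/fine_cvgP; split.
  apply: filterS2 u0 (ud _ ltr01) => t t0 t1.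
  by rewrite ge0_fin_numE// (le_lt_trans t1) ?ltry.
apply/cvgrPdist_le => d d0; apply: filterS2 u0 (ud _ d0) => t t0 td /=.
have tfin : u t \is a fin_num by rewrite ge0_fin_numE// (le_lt_trans td) ?ltry.
rewrite sub0r normrN ger0_norm ?fine_ge0//.
by rewrite -lee_fin fineK.
Qed.

Context {K : metricType R}.
Implicit Types (f g : K -> R[i]).

Lemma os_index_ge0 f a e : (0 <= os_index f a e)%E.
Proof. by apply: ereal_sup_ubound; left. Qed.

Lemma mule_os_index_ge0 f a : \forall e \near 0^'+,
  (0 <= e%:E * os_index f a e)%E.
Proof.
near=> e; rewrite mule_ge0 ?os_index_ge0// lee_fin.
by near: e; exact: nbhs_right_ge.
Unshelve. all: by end_near.
Qed.

Lemma in_SD_lim f a : in_SD f ->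
  (e%:E * os_index f a e)%E @[e --> 0^'+] --> 0%E.
Proof.
move=> fSD; apply/cvge0P => [|d d0]; first exact: mule_os_index_ge0.
have [|g [V [U [M [gfin gV VM gU Ue]]]]] := in_SD_super (e := d / 2) fSD.
  by rewrite divr_gt0.
have [m gm] := nonconst_eq0 gV VM gfin.
near=> e.
have e0 : 0 < e by near: e; exact: nbhs_right_gt.
(* [m] depends on [d] but not on [e], so the loss of [m] levels is negligible as [e] tends to 0. *)
have em : m%:R * e <= d / 2.
  have : e < d / 2 / m.+1%:R by near: e; apply: nbhs_right_lt;
    rewrite !divr_gt0.
  rewrite ltr_pdivlMr// -natr1 mulrDr mulr1 [e * _]mulrC; lra.
have : (os_index f a e <= (m%:R + d / 2 / e)%:E)%E.
  apply: ge_ereal_sup => _ [->|[n [x xn] <-]].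
    by rewrite lee_fin addr_ge0// !divr_ge0// ltW.
  have := os_super e0 gU xn (j := m) (fun h => gm x h.1).
  rewrite lee_fin -lerBlDl ler_pdivlMr// => /le_trans; exact.
move/(lee_wpmul2l (x := e%:E)) => /(_ _)/le_trans; apply.
  by rewrite lee_fin ltW.
by rewrite -EFinM lee_fin mulrDr [e * (_ / e)]mulrC divfK ?gt_eqF// [e *
  _]mulrC; lra.
Unshelve. all: by end_near.
Qed.

End index_limit.

(** * Insertion of a continuous function *)

Section inf_convolution.
Context {R : realType} {K : metricType R}.
Implicit Types (S : set K) (b phi : K -> R) (x y : K).

(** The Pasch-Hausdorff envelope: for [S] nonempty and [b] bounded below on [S], the greatest
    [n]-Lipschitz function on [K] below [b] on [S]. *)
Definition infc S b (n : nat) x :=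
  inf [set b y + n%:R * mdist x y | y in S].

Definition lsc_on S b := forall x e, S x -> 0 < e ->
  \forall y \near x, S y -> b x - e < b y.

Section infc_theory.
Variables (S : set K) (b : K -> R) (M : R) (x0 : K).
Hypotheses (Sx0 : S x0) (Mb : forall y, S y -> M <= b y).

Let lb n x y : S y -> M <= b y + n%:R * mdist x y.
Proof. by move=> Sy; rewrite -[M]addr0 lerD ?Mb// mulr_ge0// mdist_ge0. Qed.

Lemma infc_le n x y : S y -> infc S b n x <= b y + n%:R * mdist x y.
Proof.
move=> Sy; apply: inf_lbound; last by exists y.
by exists M => _ [z Sz <-]; exact: lb.
Qed.

Lemma infc_ge n x c : (forall y, S y -> c <= b y + n%:R * mdist x y) ->
  c <= infc S b n x.
Proof.
move=> h; apply: lb_le_inf; first by exists (b x0 + n%:R * mdist x x0), x0.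
by move=> _ [z Sz <-]; exact: h.
Qed.

Lemma infc_lb n x : M <= infc S b n x.
Proof. by apply: infc_ge => y; exact: lb. Qed.

Lemma infc_id n x : S x -> infc S b n x <= b x.
Proof. by move=> Sx; have := infc_le n x Sx; rewrite mdistxx mulr0 addr0. Qed.

Lemma infc_mono n m x : (n <= m)%N -> infc S b n x <= infc S b m x.
Proof.
move=> nm; apply: infc_ge => y Sy; apply: le_trans (infc_le n x Sy) _.
by rewrite lerD2l ler_wpM2r ?mdist_ge0// ler_nat.
Qed.

Lemma infc_lip n x y : infc S b n x <= infc S b n y + n%:R * mdist x y.
Proof.
rewrite -lerBlDr; apply: infc_ge => z Sz; rewrite lerBlDr.
apply: le_trans (infc_le n x Sz) _; rewrite -addrA lerD2l -mulrDr.
by rewrite ler_wpM2l// addrC metric_triangle.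
Qed.

(** Semicontinuity handles the points within [r] of [x]; for the others the penalty is at least n r,
    which suffices once n r >= b x - M. *)
Lemma infc_cvg x e : S x -> lsc_on S b -> 0 < e ->
  exists N, forall n, (N <= n)%N -> b x - e < infc S b n x.
Proof.
move=> Sx bS e0; have e20 : 0 < e / 2 by rewrite divr_gt0.
have /nbhs_ballP[r /= r0 rb] := bS x _ Sx e20.
exists (Num.truncn ((b x - M) / r)).+1 => n Nn.
suff : b x - e / 2 <= infc S b n x by lra.
apply: infc_ge => y Sy; have [yr|yr] := ltP (mdist x y) r.
  apply/ltW/(lt_le_trans (rb y _ Sy)); first by rewrite ballEmdist.
  by rewrite lerDl mulr_ge0// mdist_ge0.
have nr : b x - M <= n%:R * r.
  rewrite -ler_pdivrMr//; apply: le_trans (ltW (truncnS_gt _)) _.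
  by rewrite ler_nat.
have : n%:R * r <= n%:R * mdist x y by rewrite ler_wpM2l.
by have := Mb Sy; lra.
Qed.

End infc_theory.

Definition cont_on S phi := forall x e, S x -> 0 < e ->
  \forall y \near x, S y -> `|phi y - phi x| < e.

(* Hahn's insertion: with lower envelopes b_n increasing to b and upper
   envelopes a_n decreasing to a, sup_n min(a_n, b_n) is locally a supremum of
   finitely many Lipschitz functions, because a_N < b_N near each point for
   some N and then min(a_n, b_n) <= a_N for all n >= N. *)
Lemma hahn_insertion S (a b : K -> R) (M : R) :
  (forall x, S x -> -M <= a x) -> (forall x, S x -> b x <= M) ->
  lsc_on S (fun x => - a x) -> lsc_on S b -> (forall x, S x -> a x < b x) ->
  exists phi, cont_on S phi /\ forall x, S x -> a x <= phi x <= b x.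
Proof.
move=> Ma bM aS bS ab.
have [->|/set0P[x0 Sx0]] := eqVneq S set0; first by exists (cst 0);
  split=> [x e []|x []].
have Mb x : S x -> - M <= b x.
  by move=> Sx; apply: le_trans (Ma x Sx) (ltW (ab x Sx)).
have Ma' x : S x -> - M <= - a x.
  by move=> Sx; rewrite lerN2; apply: le_trans (ltW (ab x Sx)) (bM x Sx).
pose an n x := - infc S (fun x => - a x) n x; pose bn n x := infc S b n x.
pose m n x := Num.min (an n x) (bn n x);
  pose phi x := sup [set m n x | n in setT].
have mb n x : S x -> m n x <= b x.
  by move=> Sx; rewrite ge_min (infc_id Mb)// orbT.
have mphi n x : S x -> m n x <= phi x.
  move=> Sx; apply: sup_ubound; last by exists n.
  by exists (b x) => _ [k _ <-]; exact: mb.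
have phi_le x c : (forall n, m n x <= c) -> phi x <= c.
  move=> h; apply: ge_sup; first by exists (m 0%N x), 0%N.
  by move=> _ [k _ <-].
have aan n x : S x -> a x <= an n x.
  by move=> Sx; rewrite lerNr (infc_id Ma').
have crossing x : S x -> exists N, an N x < bn N x.
  move=> Sx; have d0 : 0 < (b x - a x) / 2 by rewrite divr_gt0// subr_gt0 ab.
  have [N1 h1] := infc_cvg Sx0 Ma' Sx aS d0.
  have [N2 h2] := infc_cvg Sx0 Mb Sx bS d0.
  exists (maxn N1 N2); rewrite /an /bn.
  by have := h1 _ (leq_maxl N1 N2); have := h2 _ (leq_maxr N1 N2); lra.
have m_lip n N x y : (n <= N)%N -> m n x <= m n y + N%:R * mdist x y.
  move=> nN; have nd : n%:R * mdist x y <= N%:R * mdist x y.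
    by rewrite ler_wpM2r ?mdist_ge0// ler_nat.
  rewrite /m -lerBlDr le_min !lerBlDr !ge_min; apply/andP; split; apply/orP.
    left; have := infc_lip Sx0 Ma' n y x; rewrite metric_sym /an; lra.
  by right; have := infc_lip Sx0 Mb n x y; rewrite /bn; lra.
(* For [n >= N], [m n x <= an n x <= an N x = m N x], so only the terms with [n <= N], all
   [N]-Lipschitz, matter at [x]. *)
have phi_lip N x y : S y -> an N x < bn N x ->
  phi x <= phi y + N%:R * mdist x y.
  move=> Sy xN; apply: phi_le => n; have [nN|/ltnW Nn] := leqP n N.
    by apply: le_trans (m_lip n N x y nN) _; rewrite lerD2r mphi.
  apply: (@le_trans _ _ (m N x)).
    rewrite [leRHS]/m (min_idPl (ltW xN)) ge_min; apply/orP; left.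
    by rewrite lerN2 (infc_mono Sx0 Ma').
  by apply: le_trans (m_lip N N x y (leqnn _)) _; rewrite lerD2r mphi.
exists phi; split=> [x e Sx e0|x Sx]; last first.
  apply/andP; split; last by apply: phi_le => n; exact: mb.
  have [N xN] := crossing x Sx; apply: le_trans (mphi N x Sx).
  by rewrite /m (min_idPl (ltW xN)) aan.
have [N xN] := crossing x Sx.
(* The first bound makes [N] times the distance less than [e]; the second preserves [an N < bn N] at
   [y], so that the Lipschitz estimate also holds from [y]. *)
pose d := Num.min (e / N.+1%:R) ((bn N x - an N x) / N.+1%:R / 2).
have d0 : 0 < d by rewrite lt_min !divr_gt0// subr_gt0.
apply/nbhs_ballP; exists d => //= y; rewrite ballEmdist /= lt_min.
rewrite -[_ / 2]mulrAC !ltr_pdivlMr// => /andP[ye yab] Sy.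
have xy0 : 0 <= mdist x y by exact: mdist_ge0.
have yd : N%:R * mdist x y <= mdist x y * N.+1%:R.
  by rewrite mulrC ler_wpM2l// ler_nat.
have yN : an N y < bn N y.
  have := infc_lip Sx0 Ma' N x y; have := infc_lip Sx0 Mb N x y.
  by move: yab; rewrite /an /bn; lra.
have := phi_lip N x y Sy xN; have := phi_lip N y x Sx yN.
rewrite (metric_sym y); move: ye yd.
by case: (ger0P (phi y - phi x)); lra.
Qed.

End inf_convolution.

(** * Decompositions into semicontinuous functions *)

Section decompositions.
Context {R : realType} {K : metricType R}.
Implicit Types (A B : set K) (p q u v V r phi : K -> R) (x y : K).

Local Notation lsc := (lsc_on setT).

Lemma lsc_onD (S : set K) p q : lsc_on S p -> lsc_on S q ->
  lsc_on S (fun x => p x + q x).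
Proof.
move=> hp hq x e Sx e0; have e20 : 0 < e / 2 by rewrite divr_gt0.
by apply: filterS2 (hp x _ Sx e20) (hq x _ Sx e20) => y py qy Sy;
  move: (py Sy) (qy Sy); lra.
Qed.

Lemma lsc_bounded p M : lsc p -> (forall x, `|p x| <= M) -> bounded_lsc p.
Proof.
move=> lp pM; split; first by exists M.
move=> x a; rewrite lte_fin => ax.
have e0 : 0 < p x - a by rewrite subr_gt0.
exists [set y | a < p y]; last by move=> y; rewrite lte_fin.
by apply: filterS (lp x _ I e0) => y /(_ I); rewrite subKr.
Qed.

(* The value 0 on B and the top value c off A keep the extension of a function
   with values in [0, c] lower semicontinuous when A and B are closed. *)
Definition shell_ext A B (c : R) u x :=
  if x \in B then 0 else if x \in A then u x else c.

Lemma shell_ext_lsc A B c u : closed A -> closed B -> B `<=` A ->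
  (forall x, (A `\` B) x -> 0 <= u x <= c) -> 0 <= c -> lsc_on (A `\` B) u ->
  lsc (shell_ext A B c u).
Proof.
move=> cA cB BA u0c c0 lu x e _ e0.
have ext0 y : 0 <= shell_ext A B c u y.
  rewrite /shell_ext; case: ifPn => // /negP yB; case: ifPn => // /set_mem yA.
  by have /u0c/andP[] : (A `\` B) y by split=> // /mem_set.
have [xB|xB] := pselect (B x).
  by apply: nearW => y _; rewrite {1}/shell_ext mem_set// sub0r (lt_le_trans _
    (ext0 y))// oppr_lt0.
have nB : \forall y \near x, ~ B y.
  by apply: open_nbhs_nbhs; split; [exact: closed_openC|].
have [xA|xA] := pselect (A x); last first.
  have nA : \forall y \near x, ~ A y.
    by apply: open_nbhs_nbhs; split; [exact: closed_openC|].
  apply: filterS2 nA nB => y yA yB _.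
  by rewrite /shell_ext !memNset// ltrBlDr ltrDl.
have xAB : (A `\` B) x by [].
apply: filterS2 nB (lu x e xAB e0) => y yB uy _.
rewrite /shell_ext (memNset xB) (memNset yB) (mem_set xA);
  case: ifPn => [/set_mem yA|_].
  exact: uy.
by have /andP[_] := u0c x xAB; move: e0; lra.
Qed.

Lemma shell_ext_bounds A B c u x : (forall x, (A `\` B) x ->
  0 <= u x <= c) -> 0 <= c ->
  0 <= shell_ext A B c u x <= c.
Proof.
move=> uc c0; rewrite /shell_ext; case: ifPn => [|/negP xB];
  first by rewrite lexx.
case: ifPn => [/set_mem xA|_]; last by rewrite c0 lexx.
by apply: uc; split=> // /mem_set.
Qed.

(** [p - q] is the simple part and [u - v] the remainder, whose D-norm will be controlled by [d]. *)
Definition simple_decomp r (d : R) := exists p q u v (C : R),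
  [/\ [/\ lsc p, lsc q, lsc u & lsc v],
      finite_set (range (p \- q)),
      forall x, 0 <= p x <= C /\ 0 <= q x <= C,
      forall x, 0 <= u x <= d /\ 0 <= v x <= d &
      forall x, r x = p x - q x + (u x - v x)].

Lemma simple_decompD r1 r2 d1 d2 : simple_decomp r1 d1 -> simple_decomp r2 d2 ->
  simple_decomp (fun x => r1 x + r2 x) (d1 + d2).
Proof.
move=> [p1 [q1 [u1 [v1 [C1 [[lp1 lq1 lu1 lv1] fin1 pC1 ud1 r1E]]]]]].
move=> [p2 [q2 [u2 [v2 [C2 [[lp2 lq2 lu2 lv2] fin2 pC2 ud2 r2E]]]]]].
exists (fun x => p1 x + p2 x), (fun x => q1 x + q2 x).
exists (fun x => u1 x + u2 x), (fun x => v1 x + v2 x), (C1 + C2); split.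
- by split; exact: lsc_onD.
- apply: sub_finite_set (finite_image2 +%R fin1 fin2) => _ [x _ <-].
  exists ((p1 \- q1) x); first by exists x.
  by exists ((p2 \- q2) x); [exists x|rewrite /=; ring].
- by move=> x; have := pC1 x; have := pC2 x; lra.
- by move=> x; have := ud1 x; have := ud2 x; lra.
- by move=> x; rewrite r1E r2E; ring.
Qed.

(* [r + V - e < r - V + e] are upper and lower semicontinuous on [A `\` B], so
   there is a continuous [phi] between them.  Rounding [phi] down to [e Z - C]
   leaves a simple upper semicontinuous [G], and [r - G] is the difference of
   [(e + (r - V - phi)) / 2 + (phi - G)] and [(e - (r + V - phi)) / 2]. *)
Lemma shell_decomp A B r V (e M : R) : closed A -> closed B -> B `<=` A ->
  0 < e -> 0 <= M ->
  (forall x, `|r x| <= M) ->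
  (forall x, (A `\` B) x -> 0 <= V x < e) ->
  (forall x d, (A `\` B) x -> 0 < d ->
     \forall y \near x, A y -> `|r y - r x| + V y <= V x + d) ->
  simple_decomp (fun x => if x \in A `\` B then r x else 0) (2 * e).
Proof.
move=> cA cB BA e0 M0 rM V0e rV; pose S := A `\` B.
have rV1 x d : S x -> 0 < d -> \forall y \near x, S y ->
  r x - V x - d < r y - V y.
  move=> Sx d0; have d20 : 0 < d / 2 by rewrite divr_gt0.
  apply: filterS (rV x _ Sx d20) => y h [/h + _].
  by case: (ger0P (r y - r x)); lra.
have rV2 x d : S x -> 0 < d -> \forall y \near x, S y ->
  r y + V y < r x + V x + d.
  move=> Sx d0; have d20 : 0 < d / 2 by rewrite divr_gt0.
  apply: filterS (rV x _ Sx d20) => y h [/h + _].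
  by case: (ger0P (r y - r x)); lra.
have rb x : - M <= r x <= M by rewrite -ler_norml.
have [phi [cphi phir]] : exists phi, cont_on S phi /\
    forall x, S x -> r x + V x - e <= phi x <= r x - V x + e.
  apply: (@hahn_insertion _ _ _ _ _ (M + e)).
  - by move=> x /V0e; have := rb x; lra.
  - by move=> x /V0e; have := rb x; lra.
  - move=> x d Sx d0; apply: filterS (rV2 x _ Sx d0) => y h /h; lra.
  - move=> x d Sx d0; apply: filterS (rV1 x _ Sx d0) => y h /h; lra.
  - by move=> x /V0e; lra.
(* On [S], [phi >= - M - e], so [phi + C] is nonnegative there and [truncn] is the floor. *)
pose C := M + e + e.
pose k x := Num.truncn ((phi x + C) / e).
pose G x := e * (k x)%:R - C.
have C0 : 0 <= C by rewrite /C; lra.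
have CC0 : 0 <= C + C by rewrite addr_ge0.
have phiC x : S x -> 0 <= (phi x + C) / e.
  move=> Sx; rewrite divr_ge0 ?ltW//.
  by have := phir x Sx; have := V0e x Sx; have := rb x; rewrite /C; lra.
have Gphi x : S x -> G x <= phi x < G x + e.
  move=> /phiC/truncn_itv; rewrite -/(k x) ler_pdivlMr// ltr_pdivrMr//.
  by rewrite -natr1 mulrDl mul1r mulrC /G; lra.
have phiM x : S x -> - C <= phi x <= C.
  by move=> Sx; have := phir x Sx; have := V0e x Sx; have := rb x;
    rewrite /C; lra.
have GC x : S x -> - C <= G x <= C.
  move=> Sx; have := phiM x Sx; have := Gphi x Sx.
  have : 0 <= e * (k x)%:R by rewrite mulr_ge0// ltW.
  by rewrite /G; set t := e * _; lra.
(* Near [x], [phi] stays below the next grid value [G x + e], so rounding down gives at most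
   [G x]. *)
have Glsc : lsc_on S (fun x => - G x).
  move=> x d Sx d0; have g0 : 0 < G x + e - phi x.
    by have := Gphi x Sx; lra.
  apply: filterS (cphi x _ Sx g0) => y yx Sy.
  have h : phi y < G x + e by move: (yx Sy); case: ger0P; lra.
  suff : G y <= G x by lra.
  rewrite lerD2r ler_pM2l// ler_nat -ltnS -(ltr_nat R) -(ltr_pM2l e0) -natr1.
  by have /andP[] := Gphi y Sy; rewrite /G in h *; rewrite mulrDr mulr1; lra.
have philsc : lsc_on S phi.
  move=> x d Sx d0; apply: filterS (cphi x _ Sx d0) => y yx Sy.
  by move: (yx Sy); case: ger0P; lra.
have phiusc : lsc_on S (fun x => - phi x).
  move=> x d Sx d0; apply: filterS (cphi x _ Sx d0) => y yx Sy.
  by move: (yx Sy); case: ger0P; lra.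
have rV1' : lsc_on S (fun x => r x - V x).
  by move=> x d Sx d0; exact: rV1.
have rV2' : lsc_on S (fun x => - r x - V x).
  by move=> x d Sx d0; apply: filterS (rV2 x _ Sx d0) => y h Sy;
    move: (h Sy); lra.
have half w : lsc_on S w -> lsc_on S (fun x => e / 2 + w x / 2).
  move=> lw x d Sx d0; apply: filterS (lw x _ Sx d0) => y h Sy; move: (h Sy);
    lra.
pose u0 x := e / 2 + (r x - V x + - phi x) / 2 + (phi x + - G x).
pose v0 x := e / 2 + (- r x - V x + phi x) / 2.
have u0lsc : lsc_on S u0 by apply: lsc_onD; [apply: half|]; exact: lsc_onD.
have v0lsc : lsc_on S v0 by apply: half; exact: lsc_onD.
have u0e x : S x -> 0 <= u0 x <= 2 * e.
  by move=> Sx; have := phir x Sx; have := V0e x Sx; have := Gphi x Sx;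
    rewrite /u0; lra.
have v0e x : S x -> 0 <= v0 x <= 2 * e.
  by move=> Sx; have := phir x Sx; have := V0e x Sx; have := Gphi x Sx;
    rewrite /v0; lra.
have q0C x : S x -> 0 <= C + - G x <= C + C.
  by move=> Sx; have := GC x Sx; lra.
have p0C x : S x -> 0 <= C <= C + C by move=> _; lra.
have cstlsc : lsc_on S (cst C).
  by move=> x d _ d0; apply: nearW => y _; rewrite /=; lra.
have e20 : 0 <= 2 * e by rewrite mulr_ge0// ltW.
(* On [S] the first difference is C - (C - G) = G; off [S] the two extensions of each pair coincide,
   being 0 on [B] and the top value off [A]. *)
exists (shell_ext A B (C + C) (cst C)),
  (shell_ext A B (C + C) (fun x => C + - G x)).
exists (shell_ext A B (2 * e) u0), (shell_ext A B (2 * e) v0), (C + C); split.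
- split; apply: shell_ext_lsc => //; exact: lsc_onD.
- pose N := Num.truncn ((C + C) / e).
  apply: (@sub_finite_set _ _ ([set 0] `|` (fun n : nat =>
    e * n%:R - C) @` `I_N.+1)).
    move=> _ [x _ <-]; rewrite /= /shell_ext.
    case: ifPn => [_|/negP xB]; first by left; rewrite subrr.
    case: ifPn => [/set_mem xA|_]; last by left; rewrite subrr.
    have Sx : S x by split=> // /mem_set.
    right; exists (k x); last by rewrite /G /=; ring.
    rewrite /= -(ltr_nat R); apply: le_lt_trans (truncnS_gt _).
    rewrite ler_pdivlMr// mulrC; have := GC x Sx; rewrite /G; lra.
  by rewrite finite_setU; split=> //; exact/finite_image/finite_II.
- by move=> x; split; exact: shell_ext_bounds.
- by move=> x; split; exact: shell_ext_bounds.
move=> x; rewrite /shell_ext; case: ifPn => [|] xS.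
  have [xA xB] := set_mem xS.
  by rewrite (mem_set xA) (memNset xB) /u0 /v0 /=; lra.
case: ifPn => [_|/negP xB]; first by ring.
case: ifPn => [/set_mem xA|_]; last by ring.
by case/negP: xS; apply/mem_set; split=> // /mem_set.
Qed.

(** The complement of [L n] is the disjoint union of the shells [L j] minus [L j.+1] with [j < n],
    and each shell costs 2 e. *)
Lemma levels_decomp (L : nat -> set K) r (e M : R) n :
  (forall j, closed (L j)) -> (forall j, L j.+1 `<=` L j) -> L 0%N = setT ->
  0 < e -> 0 <= M -> (forall x, `|r x| <= M) ->
  (forall j, exists V : K -> R,
     (forall x, (L j `\` L j.+1) x -> 0 <= V x < e) /\
     forall x d, (L j `\` L j.+1) x -> 0 < d ->
     \forall y \near x, L j y -> `|r y - r x| + V y <= V x + d) ->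
  simple_decomp (fun x => if x \in L n then 0 else r x) (n%:R * (2 * e)).
Proof.
move=> cL LS L0 e0 M0 rM LV; elim: n => [|n IH].
  exists (cst 0), (cst 0), (cst 0), (cst 0), 0.
  have l0 : lsc (cst 0 : K -> R).
    by move=> x d Sx d0; apply: nearW => y _ /=; rewrite sub0r oppr_lt0.
  split.
  - by split.
  - by apply: (@sub_finite_set _ _ [set 0]) => // _ [x _ <-] /=; rewrite subrr.
  - by move=> x; rewrite lexx.
  - by move=> x; rewrite mul0r lexx.
  - by move=> x; rewrite L0 mem_set//= !subrr addr0.
have [V [V0 rV]] := LV n.
have := simple_decompD IH
  (shell_decomp (cL n) (cL n.+1) (@LS n) e0 M0 rM V0 rV).
have -> : n.+1%:R * (2 * e) = n%:R * (2 * e) + 2 * e :> R.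
  by rewrite -[n.+1]addn1 natrD [LHS]mulrDl mul1r.
congr (simple_decomp _ _); apply: funext => x.
have [xn|xn] := pselect (L n x); last first.
  rewrite (memNset xn) memNset; last by case.
  by rewrite addr0 memNset// => /LS.
rewrite (mem_set xn) add0r; have [xn'|xn'] := pselect (L n.+1 x).
  by rewrite (mem_set xn') memNset// => -[].
by rewrite (memNset xn') mem_set.
Qed.

End decompositions.

(** * Lower semicontinuous functions as sums of continuous ones *)

Section increments.
Context {R : realType} {K : metricType R}.
Implicit Types (u : K -> R) (x : K).

(** For nonnegative lower semicontinuous [u], these are nonnegative continuous functions that
    telescope to [u]. *)
Definition infc_inc u n x : R :=
  if n is m.+1 then infc setT u n x - infc setT u m x else infc setT u 0 x.

Variables (u : K -> R) (c : R).
Hypotheses (lu : lsc_on setT u) (uc : forall x, 0 <= u x <= c).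

Let u0 y : setT y -> 0 <= u y.
Proof. by have /andP[] := uc y. Qed.

Let Tx x : [set: K] x. Proof. by []. Qed.

Lemma infc_inc_ge0 n x : 0 <= infc_inc u n x.
Proof.
case: n => [|n] /=; first exact: (infc_lb (Tx x) u0).
by rewrite subr_ge0 (infc_mono (Tx x) u0).
Qed.

Lemma sum_infc_inc n x : \sum_(0 <= j < n.+1) infc_inc u j x = infc setT u n x.
Proof.
elim: n => [|n IH]; first by rewrite big_nat1.
by rewrite big_nat_recr//= IH addrC subrK.
Qed.

Lemma sum_infc_inc_le n x : \sum_(0 <= j < n) infc_inc u j x <= u x.
Proof.
case: n => [|n]; first by rewrite big_geq// u0.
by rewrite sum_infc_inc (infc_id u0).
Qed.

Lemma sum_infc_inc_cvg x e : 0 < e ->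
  \forall n \near \oo, u x - e < \sum_(0 <= j < n) infc_inc u j x.
Proof.
move=> e0; have [N hN] := infc_cvg (Tx x) u0 (Tx x) lu e0.
by exists N.+1 => // -[//|n] /= Nn; rewrite sum_infc_inc hN.
Qed.

Lemma infc_inc_cont n x e : 0 < e ->
  \forall y \near x, `|infc_inc u n x - infc_inc u n y| < e.
Proof.
have cinfc m d : 0 < d ->
    \forall y \near x, `|infc setT u m x - infc setT u m y| < d.
  move=> d0; apply/nbhs_ballP; exists (d / m.+1%:R);
    first by rewrite /= divr_gt0.
  move=> y; rewrite ballEmdist /= ltr_pdivlMr// => yd.
  have := infc_lip (Tx x) u0 m x y; have := infc_lip (Tx x) u0 m y x.
  have : m%:R * mdist x y <= mdist x y * m.+1%:R.
    by rewrite mulrC ler_wpM2l ?mdist_ge0// ler_nat.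
  by rewrite (metric_sym y); case: ger0P; lra.
case: n => [|n] e0 /=; first exact: cinfc.
have e20 : 0 < e / 2 by rewrite divr_gt0.
apply: filterS2 (cinfc n.+1 _ e20) (cinfc n _ e20) => y h1 h2.
have -> : forall a b a' b' : R, a - b - (a' - b') = a - a' - (b - b').
  by move=> *; ring.
by apply: le_lt_trans (ler_normB _ _) _; lra.
Qed.

End increments.

(** * Bounding the D-norm *)

Section D_norm_bound.
Context {R : realType} {K : metricType R}.
Implicit Types (u : K -> R) (x : K).

Lemma normcRI (a b : R) : normc (a +i* b)%C <= `|a| + `|b|.
Proof. exact: normc_le (a +i* b)%C. Qed.

Lemma sumRI (a b : nat -> R) n : \sum_(0 <= j < n) (a j +i* b j)%C =
  ((\sum_(0 <= j < n) a j) +i* (\sum_(0 <= j < n) b j))%C.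
Proof.
elim: n => [|n IH]; first by rewrite !big_geq.
by rewrite !big_nat_recr//= IH.
Qed.

(** The increments of the four functions combine into a series for [h] whose moduli sum to at most
    u1 + v1 + u2 + v2, hence the factor 4. *)
Lemma D_norm_le (u1 v1 u2 v2 : K -> R) (h : K -> R[i]) c :
  lsc_on setT u1 -> lsc_on setT v1 -> lsc_on setT u2 -> lsc_on setT v2 ->
  (forall x, 0 <= u1 x <= c /\ 0 <= v1 x <= c) ->
  (forall x, 0 <= u2 x <= c /\ 0 <= v2 x <= c) -> 0 <= c ->
  (forall x, h x = ((u1 x - v1 x) +i* (u2 x - v2 x))%C) ->
  (D_norm h <= (4 * c)%:E)%E.
Proof.
move=> lu1 lv1 lu2 lv2 c1 c2 c0 hE.
have u1c x : 0 <= u1 x <= c by case: (c1 x).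
have v1c x : 0 <= v1 x <= c by case: (c1 x).
have u2c x : 0 <= u2 x <= c by case: (c2 x).
have v2c x : 0 <= v2 x <= c by case: (c2 x).
pose phi j x : R[i] := ((infc_inc u1 j x - infc_inc v1 j x) +i* (infc_inc u2 j
  x - infc_inc v2 j x))%C.
have phi_le j x : normc (phi j x) <= infc_inc u1 j x + infc_inc v1 j x +
  (infc_inc u2 j x + infc_inc v2 j x).
  apply: le_trans (normcRI _ _) _.
  have := infc_inc_ge0 u1c j x; have := infc_inc_ge0 v1c j x.
  have := infc_inc_ge0 u2c j x; have := infc_inc_ge0 v2c j x.
  by case: (ger0P (infc_inc u1 j x - infc_inc v1 j x));
    case: (ger0P (infc_inc u2 j x - infc_inc v2 j x)); lra.
have phic : (sup_abs_series phi <= (4 * c)%:E)%E.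
  apply: ge_ereal_sup => _ [->|[x _ <-]]; first by rewrite lee_fin mulr_ge0.
  apply: lime_le.
    by apply: is_cvg_nneseries => j _ _; rewrite lee_fin normc_ge0.
  apply: nearW => n; rewrite sumEFin lee_fin.
  apply: le_trans (ler_sum _ (fun j _ => phi_le j x)) _.
  rewrite !big_split /=.
  have := sum_infc_inc_le u1c n x; have := sum_infc_inc_le v1c n x.
  have := sum_infc_inc_le u2c n x; have := sum_infc_inc_le v2c n x.
  by have := c1 x; have := c2 x; lra.
apply: le_trans (phic); apply: ereal_inf_lbound; exists phi => //; split.
- move=> j x; apply/cvg_normcP => e e0;
    have e40 : 0 < e / 4 by rewrite divr_gt0.
  apply: filterS2
    (filterI (infc_inc_cont u1c j x e40) (infc_inc_cont v1c j x e40))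
    (filterI (infc_inc_cont u2c j x e40) (infc_inc_cont v2c j x e40)) =>
      y [h1 h2] [h3 h4].
  apply: le_lt_trans (normcRI _ _) _.
  have -> : infc_inc u1 j x - infc_inc v1 j x - (infc_inc u1 j y - infc_inc v1
    j y) =
     infc_inc u1 j x - infc_inc u1 j y - (infc_inc v1 j x - infc_inc v1 j y)
       by ring.
  have -> : infc_inc u2 j x - infc_inc v2 j x - (infc_inc u2 j y - infc_inc v2
    j y) =
     infc_inc u2 j x - infc_inc u2 j y - (infc_inc v2 j x - infc_inc v2 j y)
       by ring.
  apply: le_lt_trans (lerD (ler_normB _ _) (ler_normB _ _)) _; lra.
- by apply: le_lt_trans phic _; rewrite ltry.
move=> x; apply/cvg_normcP => e e0; have e40 : 0 < e / 4 by rewrite divr_gt0.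
apply: filterS2 (filterI (sum_infc_inc_cvg lu1 u1c x e40) (sum_infc_inc_cvg
  lv1 v1c x e40))
  (filterI (sum_infc_inc_cvg lu2 u2c x e40) (sum_infc_inc_cvg lv2 v2c x e40))
    => n [h1 h2] [h3 h4].
rewrite /series /= hE sumRI !sumrB.
move: (sum_infc_inc_le u1c n x) (sum_infc_inc_le v1c n x) (sum_infc_inc_le u2c
  n x) (sum_infc_inc_le v2c n x) h1 h2 h3 h4.
set a1 := \sum_(_ <= _ < _) infc_inc u1 _ _;
  set b1 := \sum_(_ <= _ < _) infc_inc v1 _ _.
set a2 := \sum_(_ <= _ < _) infc_inc u2 _ _;
  set b2 := \sum_(_ <= _ < _) infc_inc v2 _ _.
move=> *; apply: le_lt_trans (normcRI _ _) _.
by case: (ger0P (u1 x - v1 x - (a1 - b1)));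
  case: (ger0P (u2 x - v2 x - (a2 - b2))); lra.
Qed.

Lemma simple_decomp_SD (f : K -> R[i]) :
  (forall d, 0 < d -> simple_decomp (fun x => complex.Re (f x)) d /\
    simple_decomp (fun x => complex.Im (f x)) d) ->
  in_SD f.
Proof.
have lscM (p : K -> R) C : lsc_on setT p -> (forall x, 0 <= p x <= C) ->
  bounded_lsc p.
  move=> lp pC; apply: (@lsc_bounded _ _ _ C) => // x.
  by have /andP[p0 pC'] := pC x; rewrite ger0_norm.
move=> fd.
have step (e : R) : 0 < e -> in_D f /\ exists g,
   [/\ in_D g, finite_set (range g) & (D_norm (f \- g)%R <= (4 * e)%:E)%E].
  move=> e0; have [] := fd e e0.
  move=> [p1 [q1 [u1 [v1 [C1 [[lp1 lq1 lu1 lv1] fin1 pC1 ud1 f1E]]]]]].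
  move=> [p2 [q2 [u2 [v2 [C2 [[lp2 lq2 lu2 lv2] fin2 pC2 ud2 f2E]]]]]].
  split.
    exists (fun x => p1 x + u1 x), (fun x => q1 x + v1 x).
    exists (fun x => p2 x + u2 x), (fun x => q2 x + v2 x).
    have H C p u : lsc_on setT p -> lsc_on setT u ->
      (forall x, 0 <= p x <= C) ->
        (forall x, 0 <= u x <= e) -> bounded_lsc (fun x => p x + u x).
      move=> lp lu pC ue; apply: (@lscM _ (C + e)); first exact: lsc_onD.
      by move=> x; have := pC x; have := ue x; lra.
    split.
    - by apply: (H C1) => // x; [case: (pC1 x)|case: (ud1 x)].
    - by apply: (H C1) => // x; [case: (pC1 x)|case: (ud1 x)].
    - by apply: (H C2) => // x; [case: (pC2 x)|case: (ud2 x)].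
    - by apply: (H C2) => // x; [case: (pC2 x)|case: (ud2 x)].
    move=> x; move: (f1E x) (f2E x); rewrite /=; case: (f x) => a b /= -> ->.
    by congr (_ +i* _)%C; ring.
  exists (fun x => ((p1 x - q1 x) +i* (p2 x - q2 x))%C); split.
  - exists p1, q1, p2, q2; split => //.
    + by apply: (lscM _ C1) => // x; case: (pC1 x).
    + by apply: (lscM _ C1) => // x; case: (pC1 x).
    + by apply: (lscM _ C2) => // x; case: (pC2 x).
    + by apply: (lscM _ C2) => // x; case: (pC2 x).
  - apply: sub_finite_set (finite_image2 (fun a b => (a +i* b)%C) fin1 fin2).
    move=> _ [x _ <-].
    exists ((p1 \- q1) x); first by exists x.
    by exists ((p2 \- q2) x); first exists x.
  apply: (D_norm_le lu1 lv1 lu2 lv2) => //; first exact: ltW.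
  move=> x; move: (f1E x) (f2E x); rewrite /=; case: (f x) => a b /= -> ->.
  by congr (_ +i* _)%C; ring.
split=> [|e e0]; first by have [] := step 1 ltr01.
(* The resulting bound 4 (e / 8) = e / 2 leaves room for the strict inequality. *)
have [|_ [g [gD gfin fg]]] := step (e / 8); first by rewrite divr_gt0.
exists g; split=> //; apply: le_lt_trans fg _; rewrite lte_fin; lra.
Qed.

End D_norm_bound.

(** * Sufficiency *)

Section SD_of_index.
Context {R : realType} {K : metricType R}.
Implicit Types (f : K -> R[i]) (x y : K).

Lemma os_sub n f a e : os n.+1 f a e `<=` os n f a e.
Proof. by move=> _ /osS[w -> _]; exact: set_valP. Qed.

(** On a closed level the oscillation is upper semicontinuous, so the points where it is at least
    [e] form a closed set again. *)
Lemma os_closed n f a e : closed (os n f a e).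
Proof.
elim: n => [|n IH]; first exact: closedT.
rewrite -[X in closed X]setCK; apply: open_closedC.
rewrite openE => x xn; have [xL|xL] := pselect (os n f a e x); last first.
  have : nbhs x (~` os n f a e) by apply: open_nbhs_nbhs; split => //;
    exact: closed_openC.
  by apply: filterS => y yn /os_sub.
have xw : (osc a (@restr R K f (os n f a e)) (exist _ x (mem_set xL)) < e%:E)%E.
  rewrite ltNge; apply/negP => h; apply: xn; apply/osS.
  by exists (exist _ x (mem_set xL)).
pose P y := forall yL : os n f a e y,
  (osc a (@restr R K f (os n f a e)) (exist _ y (mem_set yL)) < e%:E)%E.
have : \forall y \near x, os n f a e y -> P y.
  apply: (@restr_nbhs R K _ (exist _ x (mem_set xL)));
    apply: filterS (osc_near xw) => w we.
  move=> wL; suff -> : exist _ (set_val w) (mem_set wL) = w by [].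
  exact: val_inj.
apply: filterS => y Py /= /osS[w yw]; rewrite leNgt => /negP; apply.
have yL : os n f a e y by rewrite yw; exact: set_valP.
suff -> : w = exist _ y (mem_set yL) by exact: Py.
exact: val_inj.
Qed.

(** The oscillation of [f] on [L] is a supersolution by hypothesis and finite where it is below [e];
    [V] carries it from the subtype over to [K]. *)
Lemma os_modulus n f a e :
  (forall w, osct_succ (@restr R K f (os n f a e)) (osc a (@restr R K f (os n
    f a e))) w
     <= osc a (@restr R K f (os n f a e)) w)%E ->
  exists V : K -> R,
  (forall x, (os n f a e `\` os n.+1 f a e) x -> 0 <= V x < e) /\
  forall x d, (os n f a e `\` os n.+1 f a e) x -> 0 < d ->
    \forall y \near x, os n f a e y -> normc (f y - f x) + V y <= V x + d.
Proof.
set L := os n f a e => fL.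
pose V x := if pselect (L x) is left h then
  fine (osc a (@restr R K f L) (exist _ x (mem_set h))) else 0.
have VE (w : L) : V (set_val w) = fine (osc a (@restr R K f L) w).
  rewrite /V; case: pselect => [h|[]]; last exact: set_valP.
  by congr (fine (osc _ _ _)); exact: val_inj.
have osce x : (L `\` os n.+1 f a e) x -> exists w : L, x = set_val w /\
    (osc a (@restr R K f L) w < e%:E)%E.
  move=> [xL xn]; exists (exist _ x (mem_set xL)); split=> //.
  rewrite ltNge; apply/negP => h; apply: xn; apply/osS.
  by exists (exist _ x (mem_set xL)).
have fin w c : (osc a (@restr R K f L) w < c%:E)%E ->
    osc a (@restr R K f L) w = (V (set_val w))%:E.
  by move=> h; rewrite VE fineK// ge0_fin_numE ?osc_ge0// (lt_trans h)// ltry.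
exists V; split=> [x /osce[w [-> we]]|x d].
  by move: (we) (osc_ge0 a (@restr R K f L) w);
    rewrite (fin _ _ we) lte_fin lee_fin => -> ->.
move=> /osce[w [-> we]] d0;
  apply: (@restr_nbhs R K L w [set y | normc (f y - f (set_val w)) + V y <= V
    (set_val w) + d]).
(* By upper semicontinuity the oscillation is finite near [w], so [fine] loses nothing there. *)
have wd : (osc a (@restr R K f L) w < (V (set_val w) + d)%:E)%E.
  by rewrite (fin _ _ we) lte_fin ltrDl.
apply: filterS2 (osc_near wd) (osct_succ_near (fL w) wd) => y yd.
by rewrite (fin _ _ yd) -EFinD lte_fin => /ltW.
Qed.

Lemma normc_ge_parts (z : R[i]) :
  `|complex.Re z| <= normc z /\ `|complex.Im z| <= normc z.
Proof.
case: z => a b /=; rewrite -!sqrtr_sqr; split; apply: ler_wsqrtr.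
  by rewrite lerDl sqr_ge0.
by rewrite lerDr sqr_ge0.
Qed.

Lemma simple_decompW (r : K -> R) d1 d2 : d1 <= d2 ->
  simple_decomp r d1 -> simple_decomp r d2.
Proof.
move=> d12 [p [q [u [v [C [lsc4 fin pC ud rE]]]]]].
exists p, q, u, v, C; split=> // x.
by have := ud x; lra.
Qed.

Lemma os_index_decomp f e n M : (forall x, normc (f x) <= M) -> 0 < e ->
  (forall W : set K, closed W -> D_index_le (@restr R K f W) Oomega) ->
  (forall x, ~ os n f Oomega e x) ->
  simple_decomp (fun x => complex.Re (f x)) (n%:R * (2 * e)) /\
  simple_decomp (fun x => complex.Im (f x)) (n%:R * (2 * e)).
Proof.
move=> fM e0 fW osn.
(* Neither part exceeds the modulus, so one [V] for [f] serves both. *)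
have key (part : R[i] -> R) : (forall z t, part z - part t = part (z - t)) ->
    (forall z, `|part z| <= normc z) ->
    simple_decomp (fun x => part (f x)) (n%:R * (2 * e)).
  move=> partB part_le.
  have -> : (fun x => part (f x)) =
      fun x => if x \in os n f Oomega e then 0 else part (f x).
    by apply: funext => x; rewrite memNset.
  apply: (@levels_decomp _ _ (fun j => os j f Oomega e) _ e `|M|) => //.
  - by move=> j; exact: os_closed.
  - by move=> j; exact: os_sub.
  - by move=> x; rewrite (le_trans (part_le _))// (le_trans (fM x))// ler_norm.
  move=> j; have [|V [V0 fV]] := @os_modulus j f Oomega e.
    move=> w; apply/osct_succ_stable/D_index_leP/fW; exact: os_closed.
  exists V; split=> // x d xj d0; apply: filterS (fV x d xj d0) => y h /h.
  by apply: le_trans; rewrite lerD2r partB.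
by split; apply: key => [[a b] [c d]|z] //; have [] := normc_ge_parts z.
Qed.

(** [n] is the least index of an empty level. If positive, the level before it is nonempty, so (n -
    1) e <= d; the off-by-one is the summand [e]. *)
Lemma os_index_bound f a e d : 0 < e -> 0 < d ->
  (e%:E * os_index f a e <= d%:E)%E ->
  exists n, (forall x, ~ os n f a e x) /\ n%:R * e <= d + e.
Proof.
move=> e0 d0 ed.
have le_d n : os n f a e !=set0 -> n%:R * e <= d.
  move=> n0; rewrite mulrC -lee_fin; apply: le_trans ed.
  rewrite EFinM; apply: lee_wpmul2l; first by rewrite lee_fin ltW.
  by apply: ereal_sup_ubound; right; exists n.
have ex : exists n, (fun n => `[< os n f a e = set0 >]) n.
  exists (Num.truncn (d / e)).+1; apply/asboolP.
  apply/eqP/negPn/negP => /set0P/le_d; apply/negP.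
  by rewrite -ltNge -ltr_pdivrMr// truncnS_gt.
have [n /asboolP n0 nmin] := ex_minnP ex.
exists n; split=> [x|]; first by rewrite n0.
case: n n0 nmin => [|n] n0 nmin; first by rewrite mul0r addr_ge0// ltW.
rewrite -natr1 mulrDl mul1r lerD2r; apply: le_d; apply/set0P/eqP => h.
by have := nmin n (asboolT h); rewrite ltnn.
Qed.

Lemma index_in_SD f M : (forall x, normc (f x) <= M) ->
  (e%:E * os_index f Oomega e)%E @[e --> 0^'+] --> 0%E ->
  (forall W : set K, closed W -> D_index_le (@restr R K f W) Oomega) ->
  in_SD f.
Proof.
move=> fM /(cvge0P _ (mule_os_index_ge0 _ _)) fi fW.
apply: simple_decomp_SD => d d0.
(* With n e <= d / 4 + e < d / 2, the total cost n (2 e) is at most [d]. *)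
have d40 : 0 < d / 4 by rewrite divr_gt0.
have [e [e0 ed fe]] : exists e, [/\
  0 < e, e < d / 4 & (e%:E * os_index f Oomega e <= (d / 4)%:E)%E].
  have : \forall e \near (0 : R)^'+, [/\
    0 < e, e < d / 4 & (e%:E * os_index f Oomega e <= (d / 4)%:E)%E].
    by near=> e; split; near: e;
      [exact: nbhs_right_gt|exact: nbhs_right_lt|exact: fi].
  by move=> /filter_ex.
have [n [osn ne]] := os_index_bound e0 d40 fe.
have [h1 h2] := os_index_decomp fM e0 fW osn.
have nd : n%:R * (2 * e) <= d by rewrite mulrCA; set t := n%:R * e in ne *; lra.
by split; [exact: simple_decompW h1|exact: simple_decompW h2].
Unshelve. all: by end_near.
Qed.

End SD_of_index.

Theorem theorem4p19 (R : realType) (K : metricType R) (f : K -> R[i])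
    (f_bounded : exists M : R, forall x, normc (f x) <= M) :
  in_SD f <->
  ((e%:E * os_index f Oomega e)%E @[e --> 0^'+] --> 0%E) /\
  (forall W : set K, closed W -> D_index_le (@restr R K f W) Oomega).
Proof.
split=> [fSD|[fi fW]]; last by case: f_bounded => M fM;
  exact: index_in_SD fM fi fW.
by split=> [|W _]; [exact: in_SD_lim|exact: in_SD_index].
Qed.
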